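(* Let $d\ge1$, $\alpha\in(0,2)$, $\beta\in(0,1)$. Let $\mu$ be a finite measure on $\mathbb S^{d-1}$ with a strictly positive density, let $w_\mu(p)=\int_{\mathbb S^{d-1}}|(p,s)|^\alpha\mu(ds)$, and assume $w_\mu\in C^{d+1+[\alpha]}(\mathbb S^{d-1})$ and $w_\mu\ge w_0>0$. Let $\Psi_\alpha(-i\nabla)$ be the pseudo-differential operator with symbol $\psi_\alpha(p)=-|p|^\alpha w_\mu(p/|p|)$, let $G_{\psi_\alpha}(s,x-y)$ be the Green's function of $\partial_su=\Psi_\alpha(-i\nabla)u$, and let $$G^{(\beta)}_{\psi_\alpha}(t,x-y)=\frac1\beta\int_0^\infty G_{\psi_\alpha}(t^\beta z,x-y)z^{-1-1/\beta}w_\beta(z^{-1/\beta})\,dz$$ be the Green's function of $D^\beta_0u=\Psi_\alpha(-i\nabla)u$. Put $\Omega=|x-y|^\alpha t^{-\beta}$. Then there exist constants $0<c\le C$ such that for all $(t,x-y)\in(0,\infty)\times\mathbb R^d$: (i) if $\Omega\le1$, $cF(t,\Omega)\le G^{(\beta)}_{\psi_\alpha}(t,x-y)\le CF(t,\Omega)$ with $F=t^{-d\beta/\alpha}$ if $d<\alpha$, $F=t^{-\beta}(|\log\Omega|+1)$ if $d=\alpha$, $F=t^{-d\beta/\alpha}\Omega^{1-d/\alpha}$ if $d>\alpha$; (ii) if $\Omega\ge1$, $c\,t^{-d\beta/\alpha}\Omega^{-1-d/\alpha}\le G^{(\beta)}_{\psi_\alpha}(t,x-y)\le C\,t^{-d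\beta/\alpha}\Omega^{-1-d/\alpha}$.
   Context: For $\beta\in(0,1)$, $w_\beta$ denotes the probability density on $(0,\infty)$ of the totally positively skewed normalised $\beta$-stable law, i.e. $\int_0^\infty e^{-\lambda x}w_\beta(x)\,dx=e^{-\lambda^\beta}$. $D^\beta_0$ is the Caputo derivative of order $\beta$ in time with base point 0. $[\alpha]$ is the integer part of $\alpha$. Known fact: under these assumptions $G_{\psi_\alpha}(s,x-y)\asymp\min(s|x-y|^{-d-\alpha},s^{-d/\alpha})$ for all $s>0$, $x,y\in\mathbb R^d$ (two-sided with constants).
   Formalization: The point x=y is excluded when d≥α, since there Ω=0, the function F is undefined (log 0 or a negative power of 0) and the integral defining the Green's function diverges; the known two-sided estimate for G_ψ is taken as a premise. *)

(* Defs.v *)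
From mathcomp Require Import all_boot all_order all_algebra.
From mathcomp Require Import all_classical all_reals all_analysis.
Import Order.TTheory GRing.Theory Num.Theory.

Set Implicit Arguments.
Unset Strict Implicit.
Unset Printing Implicit Defensive.

Import numFieldNormedType.Exports.
Local Open Scope ring_scope.
Local Open Scope classical_set_scope.

Section Defs.
Variables (R : realType) (d : nat).

(* Points of R^d are row vectors 'rV[R]_d (this carries the analysis
   structure: derivatives, continuity).  Lebesgue measure lives on the
   product sigma-algebra of d.-tuple R; [tup2row] identifies the two. *)
Definition posR : set R := `]0, +oo[%classic.

Definition tup2row (t : d.-tuple R) : 'rV[R]_d := \row_i tnth t i.

Definition dotp (p x : 'rV[R]_d) : R := \sum_i p 0 i * x 0 i.
Definition enorm (x : 'rV[R]_d) : R := Num.sqrt (dotp x x).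
Definition normalize (x : 'rV[R]_d) : 'rV[R]_d := (enorm x)^-1 *: x.

(* [lam] is Lebesgue measure on R^d: the measure on the product
   sigma-algebra giving every half-open box its volume (this determines
   it uniquely). *)
Definition box (a b : d.-tuple R) : set (d.-tuple R) :=
  [set x | forall i, tnth a i < tnth x i <= tnth b i].
Definition is_lebesgue_Rd (lam : {measure set (d.-tuple R) -> \bar R}) : Prop :=
  forall a b : d.-tuple R, (forall i, tnth a i <= tnth b i) ->
    lam (box a b) = (\prod_i (tnth b i - tnth a i))%:E.

Definition pball : set (d.-tuple R) :=
  [set t | 0 < enorm (tup2row t) <= 1].

(* Integral over the unit sphere S^{d-1} against surface measure sigma,
   defined through polar coordinates:  int_S g dsigma
   = d * int_{0<|x|<=1} g(x/|x|) dx  (for d = 1 this is counting measure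
   on {-1,1}). *)
Definition sph_int (lam : {measure set (d.-tuple R) -> \bar R})
  (g : 'rV[R]_d -> R) : R :=
  d%:R * Rintegral lam pball (fun t => g (normalize (tup2row t))).
Definition sph_int_e (lam : {measure set (d.-tuple R) -> \bar R})
  (g : 'rV[R]_d -> R) : \bar R :=
  (d%:R)%:E * \int[lam]_(t in pball) (g (normalize (tup2row t)))%:E.

(* mu(ds) = h(s) sigma(ds);  w_mu(p) = int_S |(p,s)|^alpha mu(ds). *)
Definition w_mu lam (alpha : R) (h : 'rV[R]_d -> R) (p : 'rV[R]_d) : R :=
  sph_int lam (fun s => `|dotp p s| `^ alpha * h s).

Definition psi_alpha lam alpha h (p : 'rV[R]_d) : R :=
  - (enorm p `^ alpha * w_mu lam alpha h (normalize p)).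

(* Green's function of d_s u = Psi_alpha(-i nabla) u: the inverse Fourier
   transform of exp(s psi_alpha)  (psi_alpha is real and even, so the
   imaginary part vanishes):
   G(s,x) = (2 pi)^{-d} int_{R^d} cos((p,x)) exp(s psi_alpha(p)) dp. *)
Definition G_psi lam alpha h (s : R) (x : 'rV[R]_d) : R :=
  (2 * pi) ^- d * Rintegral lam setT
    (fun t => cos (dotp (tup2row t) x) * expR (s * psi_alpha lam alpha h (tup2row t))).

Definition G_beta lam alpha h (beta : R) (w : R -> R) (t : R) (x : 'rV[R]_d) : R :=
  beta^-1 * Rintegral (@lebesgue_measure R) posR
    (fun z => G_psi lam alpha h (t `^ beta * z) x
              * z `^ (- 1 - beta^-1) * w (z `^ (- beta^-1))).

Fixpoint Ck (k : nat) (f : 'rV[R]_d -> R) : Prop :=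
  (forall x : 'rV[R]_d, x != 0 -> {for x, continuous f}) /\
  match k with
  | 0 => True
  | k'.+1 => (forall x : 'rV[R]_d, x != 0 -> forall i, derivable f x 'e_i)
             /\ (forall i, Ck k' ('D_('e_i) f))
  end.

(* A function on S^{d-1} is C^k iff its 0-homogeneous extension
   x |-> g(x/|x|) is C^k on R^d \ {0}. *)
Definition Ck_sphere (k : nat) (g : 'rV[R]_d -> R) : Prop :=
  Ck k (fun x => g (normalize x)).

(* w_beta: density of the normalised totally positively skewed beta-stable
   law:  int_0^oo e^{-lambda x} w(x) dx = e^{-lambda^beta}. *)
Definition is_stable_density (beta : R) (w : R -> R) : Prop :=
  measurable_fun posR w /\
  (forall x, 0 < x -> 0 <= w x) /\
  (forall lambda : R, 0 < lambda ->
     (\int[@lebesgue_measure R]_(x in posR) (expR (- (lambda * x)) * w x)%:E)%E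
     = (expR (- (lambda `^ beta)))%:E).

(* min(s |x|^{-d-alpha}, s^{-d/alpha}), with the convention that the first
   term is +oo at x = 0. *)
Definition Gbound (alpha s : R) (x : 'rV[R]_d) : R :=
  if x == 0 then s `^ (- (d%:R / alpha))
  else Num.min (s * enorm x `^ (- (d%:R + alpha))) (s `^ (- (d%:R / alpha))).

Definition Fsmall (alpha beta t Omega : R) : R :=
  if d%:R < alpha then t `^ (- (d%:R * beta / alpha))
  else if d%:R == alpha then t `^ (- beta) * (`|ln Omega| + 1)
  else t `^ (- (d%:R * beta / alpha)) * Omega `^ (1 - d%:R / alpha).

End Defs.

(* Main.v *)
Require Import Defs.
From HB Require Import structures.
From mathcomp Require Import all_boot all_order all_algebra.
From mathcomp Require Import all_classical all_reals all_analysis.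
From mathcomp Require Import measurable_realfun ring lra.
Import Order.TTheory GRing.Theory Num.Theory.
Import numFieldNormedType.Exports.
Local Open Scope ring_scope.
Local Open Scope classical_set_scope.
Set Implicit Arguments.
Unset Strict Implicit.
Unset Printing Implicit Defensive.

(** Substituting [z = v^-beta] turns the subordination integral into an
    expectation [E G_psi(t^beta V^-beta, x)] for [V] of density [w].  With
    [U = V^beta], [B = 1/Omega] and [m = d/alpha], the estimate of [G_psi] makes it
    comparable to [t^(-d beta/alpha) E min(B^(1+m)/U, U^m)].  Everything then
    follows from the tails of [U], which are read off the Laplace transform:
    [P(U > a) <= 2/a], [P(U <= a)] is [O(a^2)], and [P(A < U <= K A) >= c/A] for
    some [K] and all [A >= 1].  The upper bounds sum [U^m] over dyadic shells up
    to [B]; the lower bounds use one shell, or all shells below [B] when [m = 1],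
    which produces the logarithm. *)

(** * Measures with a density *)

(** The trichotomy has a single source: the tail of [U] has exponent exactly 1, so [E U^m] is finite
    for [m < 1], diverges logarithmically for [m = 1] and like a power for [m > 1]. The kernel cuts
    this moment off at [u = B], where its two branches cross. For [B <= 1] the first branch
    dominates and the mean of [1/U] takes over, which is why decay of [P(U <= a)] faster than [a] is
    needed. No asymptotics of [w] at 0 or at infinity enter. The delicate point is the lower bound
    on the mass of a shell: upper tail bounds alone cannot give it, so it is obtained as what
    remains of [1 - exp(-1/L)] after both sides of the shell have been charged, with a ratio [K]
    independent of [A]. The point [x = y] stands apart: there [Omega = 0], so [B] is infinite and
    the kernel becomes the plain power [U^m]. *)

Section density.
Local Open Scope ereal_scope.
Context d (T : measurableType d) (R : realType) (mu : {measure set T -> \bar R}).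
Variable g : T -> R.

(* The properties of [g] are arguments so that [density] is canonically a measure. *)
Definition density (mg : measurable_fun setT g) (g0 : forall x, (0 <= g x)%R) :=
  fun A : set T => \int[mu]_(x in A) (g x)%:E.

Hypothesis (mg : measurable_fun setT g) (g0 : forall x, (0 <= g x)%R).

Let density0 : density mg g0 set0 = 0.
Proof. exact: integral_set0. Qed.

Let density_ge0 A : 0 <= density mg g0 A.
Proof. by apply: integral_ge0 => x _; rewrite lee_fin. Qed.

Let density_sigma_additive : semi_sigma_additive (density mg g0).
Proof.
move=> /= F mF tF mUF; rewrite /density; apply: cvg_toP.
  apply: ereal_nondecreasing_is_cvgn => m n mn.
  by apply: lee_sum_nneg_natr => // k _ _; apply: integral_ge0 => x _; rewrite lee_fin.
rewrite ge0_integral_bigcup//=.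
- by apply/measurable_EFinP; exact: measurable_funTS.
- by move=> x _; rewrite lee_fin.
Qed.

HB.instance Definition _ := isMeasure.Build _ _ _ (density mg g0)
  density0 density_ge0 density_sigma_additive.

Import HBNNSimple.

(** Both sides are limits, by monotone convergence, of their values at the simple functions [h n].
    For a simple function each side is the sum over its values [r] of [r] times the [g]-mass of the
    level set. *)
Lemma ge0_integral_density (f : T -> \bar R) :
  measurable_fun setT f -> (forall x, 0 <= f x) ->
  \int[density mg g0]_x f x = \int[mu]_x (f x * (g x)%:E).
Proof.
move=> mf f0; pose h := nnsfun_approx measurableT mf.
have mgE : measurable_fun setT (EFin \o g) by exact/measurable_EFinP.
have mh n : measurable_fun setT (EFin \o h n).
  exact/measurable_EFinP/measurable_funP.
have -> : \int[density mg g0]_x f x =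
    limn (fun n => \int[density mg g0]_x (h n x)%:E).
  rewrite -monotone_convergence//.
  - apply: eq_integral => x _; apply/esym/cvg_lim => //.
    by apply: cvg_nnsfun_approx => // ? _; exact: f0.
  - by move=> n x _; rewrite lee_fin.
  - by move=> x _ m n mn; rewrite lee_fin; exact/lefP/nd_nnsfun_approx.
have -> : \int[mu]_x (f x * (g x)%:E) =
    limn (fun n => \int[mu]_x ((h n x)%:E * (g x)%:E)).
  rewrite -monotone_convergence//.
  - apply: eq_integral => x _; apply/esym/cvg_lim => //; apply: cvgeZr => //.
    by apply: cvg_nnsfun_approx => // ? _; exact: f0.
  - by move=> n; apply: emeasurable_funM => //; exact: mh.
  - by move=> n x _; rewrite mule_ge0 ?lee_fin.
  - move=> x _ m n mn; rewrite lee_wpmul2r ?lee_fin//.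
    exact/lefP/nd_nnsfun_approx.
congr (limn _); apply/funext => n.
transitivity (\sum_(r \in range (h n))
    (r%:E * \int[mu]_(x in h n @^-1` [set r]) (g x)%:E)).
  under eq_integral do rewrite fimfunE -fsumEFin//.
  rewrite ge0_integral_fsum//; last 2 first.
  - by move=> r; exact/measurable_EFinP/measurable_funM.
  - by move=> r x _; rewrite nnfun_muleindic_ge0.
  apply: eq_fsbigr => r _.
  by rewrite integralZl_indic_nnsfun// integral_indic// setIT.
under [in RHS]eq_integral => x _.
  rewrite fimfunE -fsumEFin// ge0_mule_fsuml; last first.
    by move=> r; rewrite nnfun_muleindic_ge0.
  over.
rewrite ge0_integral_fsum//; last 2 first.
- move=> r; apply: emeasurable_funM => //; exact/measurable_EFinP/measurable_funM.
- by move=> r x _; rewrite mule_ge0 ?nnfun_muleindic_ge0// lee_fin.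
apply: eq_fsbigr => r /set_mem[y _ <-].
under [RHS]eq_integral do rewrite EFinM -muleA.
rewrite [RHS]ge0_integralZl//; last 3 first.
- by apply: emeasurable_funM => //; apply/measurable_EFinP; exact: measurable_indic.
- by move=> x _; rewrite mule_ge0// lee_fin.
- by rewrite lee_fin.
congr (_ * _); rewrite integral_mkcond; apply: eq_integral => x _.
rewrite patchE indicE; case: ifPn => _; first by rewrite mul1e.
by rewrite mul0e.
Qed.

End density.

(** * Power substitution in Lebesgue integrals *)

Section power_substitution.
Context (R : realType).
Notation leb := (@lebesgue_measure R).

Lemma measurable_posR : measurable (@posR R).
Proof. exact: measurable_itv. Qed.

Lemma posRE (x : R) : posR x = (0 < x) :> Prop.
Proof. by rewrite /posR /= in_itv/= andbT. Qed.

Lemma in_posR (x : R) : (x \in @posR R) = (0 < x).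
Proof. by apply/idP/idP; rewrite inE posRE. Qed.

Lemma continuous_powR (p x : R) : 0 < x -> {for x, continuous (fun z => z `^ p)}.
Proof.
move=> x0; apply: differentiable_continuous; apply/derivable1_diffP.
by apply: derivable_powR; rewrite in_itv/= x0.
Qed.

Lemma powRV (x q : R) : 0 < q -> 0 < x -> (x `^ (- q^-1)) `^ (- q) = x.
Proof.
by move=> q0 x0; rewrite -powRrM mulrNN mulVf ?gt_eqF// powRr1// ltW.
Qed.

Lemma ltr_powRN (q x y : R) : 0 < q -> 0 < x -> x < y -> y `^ (- q) < x `^ (- q).
Proof.
move=> q0 x0 xy; have y0 : 0 < y by exact: lt_trans xy.
rewrite !powRN ltf_pV2 ?posrE ?powR_gt0//.
by apply: gt0_ltr_powR => //; rewrite nnegrE ltW.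
Qed.

Lemma ler_powRN (q x y : R) : 0 < q -> 0 < x -> x <= y -> y `^ (- q) <= x `^ (- q).
Proof.
by move=> q0 x0; rewrite le_eqVlt => /predU1P[->//|xy]; rewrite ltW ?ltr_powRN.
Qed.

Lemma integral_powR_tail (q c : R) : 0 < q -> 0 < c ->
  (\int[leb]_(z in `[c, +oo[) (q * z `^ (- q - 1))%:E = (c `^ (- q))%:E)%E.
Proof.
move=> q0 c0.
rewrite (@ge0_continuous_FTC2y _ _ (fun z => - z `^ (- q)) _ 0)//.
- by rewrite EFinN oppeK add0e.
- by move=> x _; rewrite mulr_ge0 ?powR_ge0// ltW.
- apply: continuous_subspaceW (_ : `[c, +oo[ `<=` @posR R) _.
    by move=> x /=; rewrite in_itv/= andbT => cx; rewrite posRE (lt_le_trans c0).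
  rewrite /posR; apply: continuous_in_subspaceT => x; rewrite inE/= in_itv/= andbT => x0.
  apply: cvgM; first exact: cvg_cst.
  exact: continuous_powR.
- rewrite -oppr0; apply: cvgN.
  apply/cvgrPdist_lt => e e0; near=> z.
  have z0 : e `^ (- q^-1) < z by near: z; apply: nbhs_pinfty_gt; exact: num_real.
  rewrite sub0r normrN ger0_norm ?powR_ge0// -[ltRHS](powRV q0 e0).
  by rewrite ltr_powRN// ?powR_gt0.
- move=> x cx; apply: derivableN; apply: derivable_powR.
  by rewrite in_itv/= andbT (lt_trans c0).
- apply: cvgN; apply: cvg_at_right_filter; exact: continuous_powR.
- move=> x; rewrite in_itv/= andbT => cx.
  have x0 : 0 < x by exact: lt_trans cx.
  rewrite derive1E deriveN; last by apply: derivable_powR; rewrite in_itv/= andbT.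
  by rewrite -derive1E powR_derive1 ?in_itv/= ?andbT// mulNr opprK.
Unshelve. all: by end_near. Qed.


Lemma measurable_powR_density (q : R) :
  measurable_fun setT ((fun z : R => q * z `^ (- q - 1)) \_ (@posR R)).
Proof.
apply/measurable_restrict => //; first exact: measurable_posR.
by apply: measurable_funTS; apply: measurable_funM => //; exact: measurable_powR.
Qed.

Lemma powR_density_ge0 (q x : R) :
  0 < q -> 0 <= ((fun z : R => q * z `^ (- q - 1)) \_ (@posR R)) x.
Proof. by move=> q0; apply: restrict_ge0 => y _; rewrite mulr_ge0 ?powR_ge0// ltW. Qed.

Local Open Scope ereal_scope.

(** For [z > 0] the condition [z^(-q) < b] says [z > b^(-1/q)], and [integral_powR_tail] gives this
    half-line mass [b]. Some [z <= 0] may satisfy it too, by the conventions for powers, but the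
    density vanishes there. *)
Lemma powR_density_itv (q b : R) : (0 < q)%R -> (0 < b)%R ->
  \int[leb]_(z in (fun z : R => (z `^ (- q))%R) @^-1` `]-oo, b[)
    (((fun z : R => q * z `^ (- q - 1)) \_ (@posR R))%R z)%:E = b%:E.
Proof.
move=> q0 b0; have c0 := powR_gt0 (- q^-1) b0.
rewrite -[in RHS](powRV q0 b0) -(integral_powR_tail q0 c0).
rewrite -integral_itv_obnd_cbnd; last first.
  apply/measurable_EFinP/measurable_funM => //.
  by apply: measurable_funTS; exact: measurable_powR.
rewrite integral_mkcond [RHS]integral_mkcond; apply: eq_integral => z _.
rewrite /patch.
have -> : (z \in (fun z : R => (z `^ (- q))%R) @^-1` `]-oo, b[) = (z `^ (- q) < b)%R.
  by apply/idP/idP; rewrite inE/= in_itv.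
rewrite in_posR mem_setE in_itv/= andbT.
have [z0|z0] := ltP 0%R z; last first.
  by rewrite if_same ltNge (le_trans z0)//= ltW.
rewrite -{1}(powRV q0 b0); congr (if _ then _ else _).
apply/idP/idP => [|/ltr_powRN -> //].
by rewrite ltNge; apply: contraTT; rewrite -!leNgt => /ler_powRN -> //.
Qed.

(** The substitution is an equality of measures: the image of [q z^(-q-1) dz] under [z^(-q)] and
    Lebesgue measure on the positive half-line both give []-oo, b[] the mass [max(b, 0)], and these
    rays form a generating class stable under intersection. Hence [F] need only be measurable and
    nonnegative. *)
Lemma ge0_integral_powR_subst (q : R) (F : R -> \bar R) : (0 < q)%R ->
  measurable_fun (@posR R) F -> (forall v, (0 < v)%R -> 0 <= F v) ->
  \int[leb]_(z in @posR R) (F (z `^ (- q))%R * (q * z `^ (- q - 1))%R%:E) =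
  \int[leb]_(v in @posR R) F v.
Proof.
move=> q0 mF F0.
pose m0 := density leb (measurable_powR_density q) (fun x => @powR_density_ge0 q x q0).
pose phi : measurableTypeR R -> measurableTypeR R := fun z => (z `^ (- q))%R.
have mphi : @measurable_fun _ _ (measurableTypeR R) (measurableTypeR R) setT phi by exact: measurable_powR.
pose m1 := pushforward m0 phi.
pose m2 := mrestr leb measurable_posR.
have m1E b : m1 `]-oo, b[ = (Order.max b 0%R)%:E.
  rewrite /m1 /pushforward/=; have [b0|b0] := ltP 0%R b.
    exact: powR_density_itv.
  rewrite (_ : phi @^-1` _ = set0); first exact: integral_set0.
  rewrite -subset0 => z /=; rewrite in_itv/= ltNge.
  by rewrite (le_trans b0) ?powR_ge0.
have m2E b : m2 `]-oo, b[ = (Order.max b 0%R)%:E.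
  rewrite /m2 /mrestr/= (_ : _ `&` _ = `]0%R, b[%classic).
    rewrite lebesgue_measure_itv/= lte_fin; by case: ltP => b0; rewrite ?sube0.
  apply/seteqP; split => z; rewrite /= posRE !in_itv/=; first by move=> [-> ->].
  by move=> /andP[].
have m12 (A : set (measurableTypeR R)) : measurable A -> pushforward m0 phi A = mrestr leb measurable_posR A.
  apply: (@measure_unique _ _ (measurableTypeR R) (@RGenInftyO.G R) (fun k => `]-oo, k%:R[%classic) _ _ _ _ (pushforward m0 phi) (mrestr leb measurable_posR)).
  - exact: RGenInftyO.measurableE.
  - move=> _ _ [x ->] [y ->]; exists (Order.min x y).
    by apply/seteqP; split => z /=; rewrite !in_itv/= lt_min => /andP.
  - by move=> i; eexists; reflexivity.
  - apply/seteqP; split => // x _.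
    exists (Num.truncn `|x|).+1 => //=; rewrite in_itv/=.
    by rewrite (le_lt_trans (ler_norm _))// truncnS_gt.
  - by move=> _ [b ->]; exact: (etrans (m1E b) (esym (m2E b))).
  - by move=> k; rewrite [ltLHS](m1E k%:R) ltry.
pose G := F \_ (@posR R).
have mG : measurable_fun setT G.
  exact: (measurable_restrictT _ measurable_posR).1.
have G0 x : 0 <= G x by apply: erestrict_ge0 => y; rewrite posRE; exact: F0.
transitivity (\int[leb]_z (G (z `^ (- q))%R * (((fun z : R => q * z `^ (- q - 1)) \_ (@posR R))%R z)%:E)).
  rewrite integral_mkcond; apply: eq_integral => z _.
  rewrite /G /patch !in_posR; have [z0|_] := ltP 0%R z; last by rewrite mule0.
  by rewrite powR_gt0.
rewrite -(@ge0_integral_density _ _ _ leb _ (measurable_powR_density q) (fun x => @powR_density_ge0 q x q0) (G \o phi)); last 2 first.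
- exact: measurableT_comp.
- by move=> x; exact: G0.
transitivity (\int[pushforward m0 phi]_x G x).
  by rewrite (ge0_integral_pushforward mphi)// preimage_setT.
rewrite -integral_mkcond; apply: eq_measure_integral => A mA Apos.
by apply: (etrans (m12 A mA)); rewrite /mrestr setIidl.
Qed.

End power_substitution.

(** * Moments from tail bounds *)

Lemma one_powR (R : realType) (p : R) : 1 `^ p = 1.
Proof. by rewrite powR1. Qed.

Lemma gt1_ltr_powR (R : realType) (a x y : R) : 1 < a -> x < y -> a `^ x < a `^ y.
Proof.
move=> a1 xy; have a0 : 0 < a by exact: lt_trans a1.
by rewrite /powR gt_eqF// ltr_expR ltr_pM2r// ln_gt0.
Qed.

Section moments.
Context d (T : measurableType d) (R : realType) (P : {measure set T -> \bar R}).
Hypothesis P1 : P setT = 1%E.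

Lemma measurable_itv_preimage (Y : T -> R) (i : interval R) :
  measurable_fun setT Y -> measurable [set x | Y x \in i].
Proof.
move=> mY; rewrite (_ : [set x | _] = setT `&` Y @^-1` [set` i]); last by rewrite setTI.
by apply: mY => //; exact: measurable_itv.
Qed.

Lemma measurable_itv_indic (Y : T -> R) (i : interval R) :
  measurable_fun setT Y -> measurable_fun setT (fun x => (Y x \in i)%:R : R).
Proof.
move=> mY; rewrite (_ : (fun x => _) = \1_[set x | Y x \in i]).
  exact/measurable_indic/measurable_itv_preimage.
by apply/funext => x; rewrite indicE; congr (nat_of_bool _)%:R; apply/idP/idP; rewrite inE.
Qed.

Lemma integral_itv_indic (Y : T -> R) (i : interval R) (r : R) :
  measurable_fun setT Y -> 0 <= r ->
  (\int[P]_x (r * (Y x \in i)%:R)%:E = r%:E * P [set x | Y x \in i])%E.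
Proof.
move=> mY r0; under eq_integral do rewrite EFinM.
rewrite ge0_integralZl//; last first.
  by apply/measurable_EFinP; exact: measurable_itv_indic.
congr (_ * _)%E; rewrite -(setIT [set x | _]) -integral_indic//; last exact: measurable_itv_preimage.
apply: eq_integral => x _; rewrite indicE; congr (nat_of_bool _)%:R%:E.
by apply/idP/idP; rewrite inE.
Qed.

Lemma le_integral_fin (f g : T -> R) :
  measurable_fun setT f -> measurable_fun setT g ->
  (forall x, 0 <= f x) -> (forall x, f x <= g x) ->
  (\int[P]_x (f x)%:E <= \int[P]_x (g x)%:E)%E.
Proof.
move=> mf mg f0 fg; apply: ge0_le_integral => //.
- by move=> x _; rewrite lee_fin.
- exact/measurable_EFinP.
- exact/measurable_EFinP.
- by move=> x _; rewrite lee_fin.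
Qed.

Lemma integral_addE (f g : T -> R) :
  measurable_fun setT f -> measurable_fun setT g ->
  (forall x, 0 <= f x) -> (forall x, 0 <= g x) ->
  (\int[P]_x (f x + g x)%:E = \int[P]_x (f x)%:E + \int[P]_x (g x)%:E)%E.
Proof.
move=> mf mg f0 g0; under eq_integral do rewrite EFinD.
rewrite ge0_integralD//; try exact/measurable_EFinP.
- by move=> x _; rewrite lee_fin.
- by move=> x _; rewrite lee_fin.
Qed.

Lemma powR2X (m : R) (k : nat) : (2 ^+ k) `^ m = (2 `^ m) ^+ k :> R.
Proof. by rewrite -[2 ^+ k]powR_mulrn// powRAC powR_mulrn// powR_ge0. Qed.

(** For [y] in []2^j, 2^(j+1)]] the term [k = j] alone is [2^((j+1)m) >= y^m], and the 1 covers
    [y <= 1]. Tail indicators let a tail bound be inserted term by term. *)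
Lemma powR_dyadic_le (y m : R) (n : nat) : 0 <= y -> 0 < m ->
  y `^ m * (y \in `]-oo, 2 ^+ n]%R)%:R <=
  1 + \sum_(k < n) 2 `^ m * (2 `^ m) ^+ k * (y \in `]2 ^+ k, +oo[%R)%:R.
Proof.
move=> y0 m0; elim: n => [|n IH].
  rewrite big_ord0 addr0 expr0 in_itv/=; case: (leP y 1) => [y1|_]; last by rewrite mulr0.
  by rewrite mulr1 -[leRHS](one_powR m) ge0_ler_powR ?nnegrE// ltW.
rewrite big_ord_recr/= addrA; move: IH; rewrite !in_itv/= andbT.
have [yn|yn] := leP y (2 ^+ n) => /= IH.
  rewrite mulr0 addr0 (le_trans _ IH)// mulr1.
  by case: (y <= _); rewrite ?mulr1 ?mulr0 ?powR_ge0.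
rewrite mulr1 ler_wpDl//.
  by rewrite addr_ge0// sumr_ge0// => k _; rewrite !mulr_ge0 ?exprn_ge0 ?powR_ge0.
case: (leP y _) => [yn1|_]; last by rewrite mulr0 mulr_ge0 ?exprn_ge0 ?powR_ge0.
by rewrite mulr1 -exprS -powR2X ge0_ler_powR ?nnegrE ?exprn_ge0// ltW.
Qed.

(** The tail bound makes the [k]-th term a constant times [2^((m-q)k)]. Whether this ratio is below,
    above or equal to 1 separates the three moment estimates below. *)
Lemma truncated_moment_le (Y : T -> R) (C q m : R) (n : nat) :
  measurable_fun setT Y -> (forall x, 0 <= Y x) -> 0 <= C -> 0 < m ->
  (forall a : R, 0 < a -> (P [set x | Y x \in `]a, +oo[%R] <= (C * a `^ (- q))%:E)%E) ->
  (\int[P]_x (Y x `^ m * (Y x \in `]-oo, 2 ^+ n]%R)%:R)%:E <=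
   (1 + C * 2 `^ m * \sum_(k < n) (2 `^ (m - q)) ^+ k)%:E)%E.
Proof.
move=> mY Y0 C0 m0 tail.
apply: (@le_trans _ _ (\int[P]_x (1 +
   \sum_(k < n) 2 `^ m * (2 `^ m) ^+ k * (Y x \in `]2 ^+ k, +oo[%R)%:R)%:E)%E).
  apply: le_integral_fin => [| |x|x].
  - apply: measurable_funM; last exact: measurable_itv_indic.
    exact: measurableT_comp (measurable_powR _) mY.
  - apply: measurable_funD => //; apply: measurable_sum => k.
    by apply: measurable_funM => //; exact: measurable_itv_indic.
  - by rewrite mulr_ge0 ?powR_ge0.
  - exact: powR_dyadic_le.
rewrite integral_addE//; last 2 first.
- apply: measurable_sum => k.
  by apply: measurable_funM => //; exact: measurable_itv_indic.
- by move=> x; rewrite sumr_ge0// => k _; rewrite !mulr_ge0 ?exprn_ge0 ?powR_ge0.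
rewrite EFinD; apply: leeD; first by rewrite integral_cst// P1 mul1e.
under eq_integral do rewrite -sumEFin.
rewrite ge0_integral_sum//; last first.
  by move=> k; apply/measurable_EFinP/measurable_funM => //; exact: measurable_itv_indic.
rewrite mulr_sumr -sumEFin; apply: lee_sum => k _.
rewrite integral_itv_indic// ?mulr_ge0 ?exprn_ge0 ?powR_ge0//.
apply: (@le_trans _ _ ((2 `^ m * (2 `^ m) ^+ k)%:E * (C * (2 ^+ k) `^ (- q))%:E)%E).
  by rewrite lee_pmul// ?tail ?exprn_gt0// lee_fin mulr_ge0 ?exprn_ge0 ?powR_ge0.
rewrite -EFinM lee_fin powR2X powRD ?pnatr_eq0 ?implybT// exprMn.
by rewrite le_eqVlt; apply/orP; left; apply/eqP; ring.
Qed.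

Lemma truncated_moment_mono (Y : T -> R) (m A B : R) :
  measurable_fun setT Y -> A <= B ->
  (\int[P]_x (Y x `^ m * (Y x \in `]-oo, A]%R)%:R)%:E <=
   \int[P]_x (Y x `^ m * (Y x \in `]-oo, B]%R)%:R)%:E)%E.
Proof.
move=> mY AB; have mYm : measurable_fun setT (fun x => Y x `^ m).
  exact: measurableT_comp (measurable_powR _) mY.
apply: le_integral_fin => [| |x|x].
- by apply: measurable_funM => //; exact: measurable_itv_indic.
- by apply: measurable_funM => //; exact: measurable_itv_indic.
- by rewrite mulr_ge0 ?powR_ge0.
- rewrite ler_wpM2l ?powR_ge0// !in_itv/= ler_nat.
  by case: (leP (Y x) A) => // YA; rewrite (le_trans YA).
Qed.

Lemma dyadic_floor (K B : R) : 1 < K -> 1 <= B ->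
  exists n : nat, [/\ K ^+ n <= B, B < K ^+ n.+1 & n%:R <= ln B / ln K].
Proof.
move=> K1 B1; have K0 : 0 < K by lra.
have B0 : 0 < B by lra.
have lK : 0 < ln K by exact: ln_gt0.
have lKB : 0 <= ln B / ln K by rewrite divr_ge0 ?ln_ge0// ltW.
have := truncn_itv lKB; set n := Num.truncn _ => /andP[n1 n2].
exists n; split => //.
- rewrite -ler_ln ?posrE ?exprn_gt0// lnXn// -mulr_natl.
  by rewrite -ler_pdivlMr.
- rewrite -ltr_ln ?posrE ?exprn_gt0// lnXn// -mulr_natl.
  by rewrite -ltr_pdivrMr.
Qed.

(** * Moments under a power tail: below, above and at the critical exponent *)

Section tail.
Variables (Y : T -> R) (C q : R).
Hypotheses (mY : measurable_fun setT Y) (Y0 : forall x, 0 <= Y x) (C0 : 0 <= C).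
Hypothesis tail : forall a : R, 0 < a ->
  (P [set x | Y x \in `]a, +oo[%R] <= (C * a `^ (- q))%:E)%E.

(** The ratio is below 1, so the full geometric series bounds the truncated moments uniformly in the
    cut-off, which monotone convergence then removes. *)
Lemma moment_lt_tail (m : R) : 0 < m -> m < q ->
  exists2 K : R, 1 <= K & (\int[P]_x (Y x `^ m)%:E <= K%:E)%E.
Proof.
move=> m0 mq; set r := 2 `^ (m - q) : R.
have r0 : 0 <= r by exact: powR_ge0.
have r1 : r < 1 by rewrite -[ltRHS](powRr0 2); apply: gt1_ltr_powR; lra.
exists (1 + C * 2 `^ m * (1 - r)^-1).
  by rewrite lerDl !mulr_ge0 ?powR_ge0// invr_ge0; lra.
pose g n x := (Y x `^ m * (Y x \in `]-oo, 2 ^+ n]%R)%:R)%:E.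
have mYm : measurable_fun setT (fun x => Y x `^ m).
  exact: measurableT_comp (measurable_powR _) mY.
have mg n : measurable_fun setT (g n).
  by apply/measurable_EFinP/measurable_funM => //; exact: measurable_itv_indic.
have g_cvg x : (fun n => g n x) @ \oo --> (Y x `^ m)%:E.
  apply: cvg_near_cst; near=> n; rewrite /g in_itv/=.
  suff -> : Y x <= 2 ^+ n by rewrite mulr1.
  rewrite (le_trans (ltW (truncnS_gt _)))// -natrX ler_nat.
  rewrite (leq_trans _ (ltnW (ltn_expl n (ltnSn 1))))//.
  by near: n; exact: nbhs_infty_ge.
have -> : (\int[P]_x (Y x `^ m)%:E = limn (fun n => \int[P]_x g n x))%E.
  rewrite -monotone_convergence//.
  - by apply: eq_integral => x _; apply/esym/cvg_lim.
  - by move=> n x _; rewrite lee_fin mulr_ge0 ?powR_ge0.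
  - move=> x _ i j ij; rewrite lee_fin ler_wpM2l ?powR_ge0// !in_itv/= ler_nat.
    case: (leP (Y x) (2 ^+ i)) => // Yi; rewrite (le_trans Yi)// ler_weXn2l//; lra.
apply: lime_le.
  apply: ereal_nondecreasing_is_cvgn => i j ij; apply: truncated_moment_mono => //.
  rewrite ler_weXn2l//; lra.
apply: nearW => n; apply: (le_trans (truncated_moment_le n mY Y0 C0 m0 tail)).
rewrite lee_fin lerD2l ler_wpM2l ?mulr_ge0 ?powR_ge0// -/r.
rewrite -div1r ler_pdivlMr; last lra.
have := subrX1 r n; have := exprn_ge0 n r0; lra.
Unshelve. all: by end_near. Qed.

(** The ratio exceeds 1, so the geometric sum is of the order of its last term. *)
Lemma truncated_moment_gt_tail (m : R) : 0 < m -> q < m ->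
  exists2 K : R, 1 <= K & forall B : R, 1 <= B ->
    (\int[P]_x (Y x `^ m * (Y x \in `]-oo, B]%R)%:R)%:E <= (K * B `^ (m - q))%:E)%E.
Proof.
move=> m0 mq; set r := 2 `^ (m - q) : R.
have r1 : 1 < r by rewrite -[ltLHS](powRr0 2); apply: gt1_ltr_powR; lra.
have K0 : 0 <= C * 2 `^ m * r / (r - 1) by rewrite !mulr_ge0 ?powR_ge0// ?invr_ge0; lra.
exists (1 + C * 2 `^ m * r / (r - 1)) => [|B B1]; first by rewrite lerDl.
(* The cut-off is raised from [B] to [2^(n+1)], while the estimate keeps [2^n <= B]; the factor [r]
   in the constant pays for the difference. *)
have [n [n1 n2 _]] := dyadic_floor (ltr1n R 2) B1.
apply: (le_trans (truncated_moment_mono m mY (ltW n2))).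
apply: (le_trans (truncated_moment_le n.+1 mY Y0 C0 m0 tail)).
rewrite lee_fin mulrDl mul1r; apply: lerD.
  by rewrite -[leLHS](powRr0 B) ler_powR// subr_ge0 ltW.
rewrite -/r (_ : C * 2 `^ m * r / (r - 1) * B `^ (m - q) =
  C * 2 `^ m * (r / (r - 1) * B `^ (m - q))); last ring.
rewrite ler_wpM2l ?mulr_ge0 ?powR_ge0//.
have -> : \sum_(k < n.+1) r ^+ k = (r ^+ n.+1 - 1) / (r - 1).
  by rewrite subrX1 mulrAC mulfV ?mul1r//; lra.
rewrite mulrAC ler_wpM2r ?invr_ge0 ?subr_ge0 ?ltW// exprS.
have : r ^+ n <= B `^ (m - q).
  by rewrite /r -powR2X ge0_ler_powR ?nnegrE ?exprn_ge0// ?subr_ge0 ltW//; lra.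
have r0 : 0 <= r by exact: powR_ge0.
by move=> /(ler_wpM2l r0); lra.
Qed.

(** At the critical exponent all shells contribute equally, and about [ln B / ln 2] of them lie
    below [B]. *)
Lemma truncated_moment_eq_tail : 0 < q ->
  exists2 K : R, 1 <= K & forall B : R, 1 <= B ->
    (\int[P]_x (Y x `^ q * (Y x \in `]-oo, B]%R)%:R)%:E <= (K * (ln B + 1))%:E)%E.
Proof.
move=> q0.
exists (1 + C * 2 `^ q * (1 + (ln 2)^-1)) => [|B B1].
  by rewrite lerDl !mulr_ge0 ?powR_ge0// addr_ge0// invr_ge0 ln_ge0//; lra.
have [n [n1 n2 n3]] := dyadic_floor (ltr1n R 2) B1.
apply: (le_trans (truncated_moment_mono q mY (ltW n2))).
apply: (le_trans (truncated_moment_le n.+1 mY Y0 C0 q0 tail)).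
rewrite lee_fin subrr powRr0.
have -> : \sum_(k < n.+1) 1 ^+ k = n%:R + 1 :> R.
  by under eq_bigr do rewrite expr1n; rewrite sumr_const card_ord natr1.
set c := C * _; have c0 : 0 <= c by rewrite mulr_ge0 ?powR_ge0.
have L0 : 0 <= ln B by exact: ln_ge0.
have l0 : 0 <= (ln 2 : R)^-1 by rewrite invr_ge0 ln_ge0//; lra.
have := ler_wpM2l c0 n3; have := mulr_ge0 c0 L0; have := mulr_ge0 c0 l0.
nra.
Qed.

End tail.

End moments.

(** * Stable laws *)

(* In the application [U = V^beta] and [b = 1/beta], so that [laplace] is the
   Laplace transform of [V] at [a^(-1/beta)]. *)
Section stable.
Context d (T : measurableType d) (R : realType) (P : {measure set T -> \bar R}).
Variables (U : T -> R) (b : R).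
Hypotheses (P1 : P setT = 1%E) (mU : measurable_fun setT U).
Hypotheses (U0 : forall x, 0 <= U x) (b1 : 1 < b).
Hypothesis laplace : forall a : R, 0 < a ->
  (\int[P]_x (expR (- (U x / a) `^ b))%:E = (expR (- a^-1))%:E)%E.

Let mlap a : measurable_fun setT (fun x => expR (- (U x / a) `^ b)).
Proof.
apply: measurableT_comp => //; apply: measurableT_comp => //.
by apply: (measurableT_comp (measurable_powR _)); exact: measurable_funM.
Qed.

Let measurable_inv : measurable_fun setT (fun x => (U x)^-1).
Proof.
under eq_fun do rewrite -powR_inv1//.
exact: measurableT_comp (measurable_powR _) mU.
Qed.

Let b0 : 0 < b. Proof. exact: lt_trans b1. Qed.

(** * Tails of [U] read off its Laplace transform *)

Lemma expRN1_le_half : expR (- 1) <= 2^-1 :> R.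
Proof.
by rewrite expRN lef_pV2 ?posrE ?expR_gt0//; have := expR_ge1Dx (1 : R); lra.
Qed.

Lemma laplace_compl (a : R) : 0 < a ->
  (\int[P]_x (1 - expR (- (U x / a) `^ b))%:E = (1 - expR (- a^-1))%:E)%E.
Proof.
move=> a0; set I := LHS.
have : (I + (expR (- a^-1))%:E = 1)%E.
  rewrite -laplace// /I -integral_addE//.
  - by under eq_integral do rewrite subrK; rewrite integral_cst// P1 mul1e.
  - exact: measurable_funB.
  - by move=> x; rewrite subr_ge0 expR_le1 oppr_le0 powR_ge0.
by rewrite EFinB => <-; rewrite addeK.
Qed.

(** Markov's inequality for [1 - exp(-(U/a)^b)], which is at least [1 - 1/e >= 1/2] where [U > a]
    and has mean [1 - exp(-1/a) <= 1/a]. *)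
Lemma upper_tail (a : R) : 0 < a -> (P [set x | U x \in `]a, +oo[%R] <= (2 * a `^ (- 1))%:E)%E.
Proof.
move=> a0; rewrite EFinM -lee_pdivrMl//.
rewrite -integral_itv_indic//.
apply: (@le_trans _ _ (\int[P]_x (1 - expR (- (U x / a) `^ b))%:E)%E).
  apply: le_integral_fin => [| |x|x].
  - by apply: measurable_funM => //; exact: measurable_itv_indic.
  - exact: measurable_funB.
  - by rewrite mulr_ge0.
  - rewrite in_itv/= andbT; case: ltP => [aU|_]; last first.
      by rewrite mulr0 subr_ge0 expR_le1 oppr_le0 powR_ge0.
    have : 1 <= (U x / a) `^ b.
      rewrite -[leLHS](powRr0 (U x / a)) ler_powR//; last exact: ltW.
      by rewrite ler_pdivlMr// mul1r ltW.
    move=> h; have : expR (- (U x / a) `^ b) <= expR (- 1) by rewrite ler_expR lerN2.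
    by have := expRN1_le_half; rewrite mulr1; lra.
rewrite laplace_compl// lee_fin powR_inv1 ?(ltW a0)//.
by have := expR_ge1Dx (- a^-1); lra.
Qed.

(** Where [U < 1/a], the variable [exp(-(aU)^b)] is at least [1/e], while its mean is
    [exp(-a) <= 2/a^2]. The power 2 is a choice: any exponent above 1 makes the mean of [1/U]
    finite. Phrasing it as a tail of [1/U] brings it under [moment_lt_tail]. *)
Lemma lower_tail (a : R) : 0 < a ->
  (P [set x | (U x)^-1%R \in `]a, +oo[%R] <= (2 * expR 1 * a `^ (- 2))%:E)%E.
Proof.
move=> a0.
have mV := measurable_inv.
have -> : 2 * expR 1 * a `^ (- 2) = expR 1 * (2 * a `^ (- 2)) by ring.
rewrite EFinM -lee_pdivrMl ?expR_gt0// -expRN -integral_itv_indic ?expR_ge0//.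
apply: (@le_trans _ _ (\int[P]_x (expR (- (U x / a^-1) `^ b))%:E)%E).
  apply: le_integral_fin => [| |x|x].
  - by apply: measurable_funM => //; exact: measurable_itv_indic.
  - exact: mlap.
  - by rewrite mulr_ge0 ?expR_ge0.
  - rewrite in_itv/= andbT; case: ltP => [aU|_]; last by rewrite mulr0 expR_ge0.
    have Ux : 0 < U x by rewrite -invr_gt0 (lt_trans a0).
    rewrite mulr1 ler_expR lerN2 invrK -[leRHS](one_powR b).
    rewrite ge0_ler_powR ?nnegrE ?(ltW b0)// ?mulr_ge0 ?(ltW a0)//.
    by rewrite -ler_pdivlMl// mulr1 ltW.
rewrite laplace ?invr_gt0// invrK lee_fin expRN powR_invn ?(ltW a0)//.
rewrite -[2 * _]invrK lef_pV2 ?posrE ?expR_gt0 ?invr_gt0 ?mulr_gt0 ?invr_gt0 ?exprn_gt0//.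
rewrite invfM invrK.
by have := expR_ge1Dxn 1 (ltW a0); rewrite /= [_`!%:R]/(2%:R); lra.
Qed.

Lemma reciprocal_moment :
  exists2 K : R, 1 <= K & (\int[P]_x ((U x)^-1)%:E <= K%:E)%E.
Proof.
have C0 : 0 <= 2 * expR 1 :> R by rewrite mulr_ge0// expR_ge0.
have V0 x : 0 <= (U x)^-1 by rewrite invr_ge0.
have [K K1 HK] := moment_lt_tail P1 measurable_inv V0 C0 lower_tail
  (ltr01 : 0 < 1 :> R) (ltr1n R 2).
by exists K => //; under eq_integral do rewrite -[_^-1]powRr1//.
Qed.

(* With [A = dl * L], the mean of [1 - exp(-(U/L)^b)] is at least [1/(2L)], while
   the parts [U <= A] and [U > K A] each contribute at most [1/(8L)]: the former
   because [b > 1] and [dl] is small, the latter by [upper_tail]. *)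
Lemma dyadic_shell_ge : exists K c : R, [/\ 1 < K, 0 < c & forall A : R, 1 <= A ->
  ((c / A)%:E <= P [set x | U x \in `]A, K * A]%R])%E].
Proof.
have two0 : 0 <= 2 :> R by [].
have [K0 K01 HK0] := truncated_moment_gt_tail P1 mU U0 two0 upper_tail b0 b1.
have K0gt : 0 < K0 by lra.
have bm : 0 < b - 1 by rewrite subr_gt0.
(* Solves [K0 * dl^(b-1) = 1/8]. Being at most 1, it also gives [L = A/dl >= 1], the range where
   [1 - exp(-1/L) >= 1/(2L)] is proved. *)
pose dl : R := (8 * K0)^-1 `^ (b - 1)^-1.
have i0 : 0 < (8 * K0)^-1 by rewrite invr_gt0; lra.
have dl0 : 0 < dl by exact: powR_gt0.
have dl1 : dl <= 1.
  rewrite -[leRHS](one_powR (b - 1)^-1) ge0_ler_powR ?nnegrE//.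
  - by rewrite invr_ge0 ltW.
  - exact: ltW.
  - rewrite invf_le1; lra.
have dlb : K0 * dl `^ (b - 1) = 8^-1.
  rewrite -powRrM mulVf ?gt_eqF// powRr1 ?(ltW i0)// invfM mulrCA mulfV ?mulr1//.
  by rewrite gt_eqF.
(* The upper end [K A] equals [16 L], where [upper_tail] leaves [2/(16L) = 1/(8L)]. The shell keeps
   [1/(2L) - 2/(8L) = 1/(4L) = (dl/4)/A]. *)
exists (16 / dl), (dl / 4); split.
- by rewrite ltr_pdivlMr//; lra.
- by lra.
move=> A A1; have A0 : 0 < A by lra.
pose L := A / dl; have L0 : 0 < L by exact: divr_gt0.
have L1 : 1 <= L by rewrite ler_pdivlMr//; lra.
pose K := 16 / dl.
have K1 : 1 < K by rewrite ltr_pdivlMr//; lra.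
have AK : A < K * A by rewrite ltr_pMl.
have mT (i : interval R) := measurable_itv_indic i mU.
have mUb : measurable_fun setT (fun x => U x `^ b).
  exact: measurableT_comp (measurable_powR _) mU.
(* On [U <= A] the inequality [1 - exp(-y) <= y] is applied to [y = (U/L)^b]; on the two other
   ranges the integrand is bounded by 1. *)
have step : ((1 - expR (- L^-1))%:E <=
    (L `^ (- b) * (K0 * A `^ (b - 1)))%:E + P [set x | U x \in `]A, K * A]%R]
      + (2 * (K * A) `^ (- 1))%:E)%E.
  rewrite -laplace_compl//.
  apply: (@le_trans _ _ (\int[P]_x (L `^ (- b) * (U x `^ b * (U x \in `]-oo, A]%R)%:R) +
     1 * (U x \in `]A, K * A]%R)%:R + 1 * (U x \in `]K * A, +oo[%R)%:R)%:E)%E).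
    apply: le_integral_fin => [| |x|x].
    - exact: measurable_funB.
    - by do !apply: measurable_funD; do ?apply: measurable_funM.
    - by rewrite subr_ge0 expR_le1 oppr_le0 powR_ge0.
    - have e0 := expR_ge0 (- (U x / L) `^ b).
      rewrite !in_itv/= andbT; case: (leP (U x) A) => [UA|UA]/=; last first.
        case: (leP (U x) (K * A)) => /= _; rewrite ?mulr0 ?mulr1; lra.
      rewrite ltNge (le_trans UA (ltW AK))/= !mulr0 !addr0 mulr1.
      have := expR_ge1Dx (- (U x / L) `^ b).
      by rewrite powRM ?invr_ge0 ?(ltW L0)// -powR_inv1 ?(ltW L0)// -powRrM mulN1r; lra.
  rewrite integral_addE; last 4 first.
  - by do !apply: measurable_funD; do ?apply: measurable_funM.
  - exact: measurable_funM.
  - by move=> x; rewrite addr_ge0 ?mulr_ge0 ?powR_ge0.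
  - by move=> x; rewrite mulr_ge0.
  rewrite integral_itv_indic// mul1e leeD//; last by apply: upper_tail; rewrite mulr_gt0//; lra.
  rewrite integral_addE; last 4 first.
  - by do ?apply: measurable_funM.
  - exact: measurable_funM.
  - by move=> x; rewrite !mulr_ge0 ?powR_ge0.
  - by move=> x; rewrite mulr_ge0.
  rewrite integral_itv_indic// mul1e leeD//.
  under eq_integral do rewrite EFinM.
  rewrite ge0_integralZl//; last 3 first.
  - by apply/measurable_EFinP/measurable_funM.
  - by move=> x _; rewrite lee_fin mulr_ge0 ?powR_ge0.
  - by rewrite lee_fin powR_ge0.
  by rewrite EFinM lee_pmul2l ?lte_fin ?powR_gt0// HK0.
have AL : A = L * dl by rewrite /L divfK ?gt_eqF.
have e1 : L `^ (- b) * (K0 * A `^ (b - 1)) = 8^-1 * L^-1.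
  have -> : L^-1 = L `^ (- b) * L `^ (b - 1).
    rewrite -(powR_inv1 (ltW L0)) -powRD; first by congr (_ `^ _); ring.
    by rewrite (gt_eqF L0) implybT.
  by rewrite AL powRM ?(ltW L0) ?(ltW dl0)// -dlb; ring.
have e2 : 2 * (K * A) `^ (- 1) = 8^-1 * L^-1.
  have -> : K * A = 16 * L by rewrite /K /L; ring.
  rewrite powR_inv1; first by field; rewrite gt_eqF.
  by rewrite mulr_ge0// ltW.
(* From [exp(-x) <= 1/(1+x)] comes [1 - exp(-x) >= x/(1+x) >= x/2] for [x <= 1]. *)
have e3 : 2^-1 * L^-1 <= 1 - expR (- L^-1).
  set x := L^-1; have x0 : 0 < x by rewrite invr_gt0.
  have x1 : x <= 1 by rewrite invf_le1.
  have y0 := expR_ge0 (- x); have y1 := expRxMexpNx_1 x.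
  have y2 := ler_wpM2r y0 (expR_ge1Dx x).
  by nra.
have -> : dl / 4 / A = 4^-1 * L^-1 by rewrite /L invf_div; ring.
move: step; rewrite e1 e2; case: (P _) => [r| |]//=.
  by rewrite -!EFinD !lee_fin; lra.
by move=> _; exact: leey.
Qed.

(* [Gbound alpha (t^beta v^-beta) x] divided by [t^(-d beta/alpha)], where
   [m = d/alpha], [B = 1/Omega] and [u = v^beta]. *)
Definition stable_kernel (m B u : R) := Num.min (B `^ (1 + m) / u) (u `^ m).
Local Notation M := stable_kernel.

(** * Integrals of the kernel in each regime of [m] and [B] *)

Lemma measurable_stable_kernel (m B : R) : measurable_fun setT (fun x => M m B (U x)).
Proof.
apply: measurable_minr; first exact: measurable_funM.
exact: measurableT_comp (measurable_powR _) mU.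
Qed.

Lemma stable_kernel_ge0 m B u : 0 <= u -> 0 <= M m B u.
Proof. by move=> u0; rewrite le_min !mulr_ge0 ?invr_ge0 ?powR_ge0. Qed.

Let mUm (m : R) : measurable_fun setT (fun x => U x `^ m).
Proof. exact: measurableT_comp (measurable_powR _) mU. Qed.

Lemma stable_kernel_le_moment (m B : R) :
  (\int[P]_x (M m B (U x))%:E <= \int[P]_x (U x `^ m)%:E)%E.
Proof.
apply: le_integral_fin => // [|x|x]; first exact: measurable_stable_kernel.
- exact: stable_kernel_ge0.
- by rewrite /M ge_min lexx orbT.
Qed.

(** Above the crossing point [u = B] the first branch is at most [B^m], on an event of probability
    at most [2/B]; below it the second branch is kept. *)
Lemma stable_kernel_le_truncated (m B : R) : 0 < m -> 0 < B ->
  (\int[P]_x (M m B (U x))%:E <=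
   \int[P]_x (U x `^ m * (U x \in `]-oo, B]%R)%:R)%:E + (2 * B `^ (m - 1))%:E)%E.
Proof.
move=> m0 B0; have mI := measurable_itv_indic _ mU.
apply: (@le_trans _ _ (\int[P]_x (U x `^ m * (U x \in `]-oo, B]%R)%:R +
    B `^ m * (U x \in `]B, +oo[%R)%:R)%:E)%E).
  apply: le_integral_fin => [| |x|x].
  - exact: measurable_stable_kernel.
  - by apply: measurable_funD; exact: measurable_funM.
  - exact: stable_kernel_ge0.
  - rewrite !in_itv/= andbT /M; case: (leP (U x) B) => UB.
      by rewrite mulr0 addr0 mulr1 ge_min lexx orbT.
    rewrite mulr0 add0r mulr1 ge_min; apply/orP; left.
    have U1 : 0 < U x by exact: lt_trans UB.
    rewrite ler_pdivrMr// powRD ?(gt_eqF B0) ?implybT// powRr1 ?(ltW B0)// mulrC.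
    by rewrite ler_wpM2l ?powR_ge0// ltW.
rewrite integral_addE; last 4 first.
- exact: measurable_funM.
- exact: measurable_funM.
- by move=> x; rewrite mulr_ge0 ?powR_ge0.
- by move=> x; rewrite mulr_ge0 ?powR_ge0.
rewrite leeD2l// integral_itv_indic ?powR_ge0//.
apply: (@le_trans _ _ ((B `^ m)%:E * (2 * B `^ (- 1))%:E)%E).
  by rewrite lee_pmul2l ?lte_fin ?powR_gt0// upper_tail.
by rewrite -EFinM lee_fin powRD ?(gt_eqF B0) ?implybT// mulrCA.
Qed.

Lemma stable_kernel_small_upper (m : R) :
  exists2 K : R, 1 <= K & forall B : R, 0 < B ->
    (\int[P]_x (M m B (U x))%:E <= (K * B `^ (1 + m))%:E)%E.
Proof.
have [K K1 HK] := reciprocal_moment; exists K => // B B0.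
apply: (@le_trans _ _ (\int[P]_x (B `^ (1 + m) * (U x)^-1)%:E)%E).
  apply: le_integral_fin => [| |x|x].
  - exact: measurable_stable_kernel.
  - exact: measurable_funM.
  - exact: stable_kernel_ge0.
  - by rewrite /M ge_min lexx.
under eq_integral do rewrite EFinM.
rewrite ge0_integralZl//; last 3 first.
- exact/measurable_EFinP.
- by move=> x _; rewrite lee_fin invr_ge0.
- by rewrite lee_fin powR_ge0.
by rewrite mulrC EFinM lee_pmul2l ?lte_fin ?powR_gt0.
Qed.

Lemma stable_kernel_shell_lower (K c A mu m B : R) : 1 < K -> 0 < c -> 1 <= A -> 0 <= mu ->
  ((c / A)%:E <= P [set x | U x \in `]A, K * A]%R])%E ->
  (forall u, A < u -> u <= K * A -> mu <= M m B u) ->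
  ((mu * (c / A))%:E <= \int[P]_x (M m B (U x))%:E)%E.
Proof.
move=> K1 c0 A1 mu0 shell Hmu.
apply: (@le_trans _ _ (\int[P]_x (mu * (U x \in `]A, K * A]%R)%:R)%:E)%E).
  rewrite integral_itv_indic// EFinM; apply: lee_wpmul2l => //.
apply: le_integral_fin => [| |x|x].
- by apply: measurable_funM => //; exact: measurable_itv_indic.
- exact: measurable_stable_kernel.
- by rewrite mulr_ge0.
- rewrite in_itv/=; case: andP => [[h1 h2]|_]; first by rewrite mulr1 Hmu.
  by rewrite mulr0 stable_kernel_ge0.
Qed.

Let two0 : 0 <= 2 :> R. Proof. by []. Qed.

Let powRBD1 (m B : R) : 0 < B -> B `^ (1 + m) = B * B `^ m.
Proof. by move=> B0; rewrite powRD ?(gt_eqF B0) ?implybT// powRr1 ?ltW. Qed.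

Let powR_ge1 (m B : R) : 0 <= m -> 1 <= B -> 1 <= B `^ m.
Proof. by move=> m0 B1; rewrite -[leLHS](powRr0 B) ler_powR. Qed.

(** Values of [U] of order [B] dominate: on the shell just above [B] the kernel is at least
    [B^m / K] and the probability at least [c/B]. *)
Lemma stable_kernel_gt (m : R) : 1 < m -> exists c C : R, [/\ 0 < c, c <= C & forall B : R, 1 <= B ->
  ((c * B `^ (m - 1))%:E <= \int[P]_x (M m B (U x))%:E /\
   \int[P]_x (M m B (U x))%:E <= (C * B `^ (m - 1))%:E)%E].
Proof.
move=> m1; have m0 : 0 < m by exact: lt_trans m1.
have [K0 K01 HK0] := truncated_moment_gt_tail P1 mU U0 two0 upper_tail m0 m1.
have [K [c [K1 c0 shell]]] := dyadic_shell_ge.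
have Kp : 0 < K by lra.
have cK : 0 < c / K by exact: divr_gt0.
exists (c / K), (c / K + K0 + 2); split => [//||B B1]; first lra.
have B0 : 0 < B by lra.
split.
  have -> : c / K * B `^ (m - 1) = B `^ m / K * (c / B).
    by rewrite powRD ?(gt_eqF B0) ?implybT// powR_inv1 ?(ltW B0)//; ring.
  apply: (stable_kernel_shell_lower K1 c0 B1 _ (shell _ B1)).
    by rewrite mulr_ge0 ?powR_ge0// invr_ge0 ltW.
  move=> u Bu uKB; have u0 : 0 < u by exact: lt_trans Bu.
  rewrite le_min; apply/andP; split.
    rewrite powRBD1// ler_pdivlMr// mulrAC -mulrA [leRHS]mulrC.
    by rewrite ler_wpM2l ?powR_ge0// ler_pdivrMr// mulrC.
  apply: (@le_trans _ _ (B `^ m)).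
    by rewrite ler_pdivrMr// ler_peMr ?powR_ge0// ltW.
  by rewrite ge0_ler_powR ?nnegrE// ltW.
apply: (le_trans (stable_kernel_le_truncated m0 B0)).
apply: (@le_trans _ _ ((K0 * B `^ (m - 1))%:E + (2 * B `^ (m - 1))%:E)%E).
  by rewrite leeD2r// HK0.
by rewrite -EFinD lee_fin -mulrDl ler_wpM2r ?powR_ge0//; lra.
Qed.

(** On the shell []1, K]] the kernel is at least [min(1, B^(1+m)) / K]; this one bound serves both
    [B >= 1] and [B <= 1]. *)
Let shell_one (K c m B : R) : 1 < K -> 0 < c -> 0 < m -> 0 < B ->
  (forall A : R, 1 <= A -> ((c / A)%:E <= P [set x | U x \in `]A, K * A]%R])%E) ->
  ((Num.min 1 (B `^ (1 + m)) * (c / K))%:E <= \int[P]_x (M m B (U x))%:E)%E.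
Proof.
move=> K1 c0 m0 B0 shell; have Kp : 0 < K by lra.
set r := Num.min _ _; have r0 : 0 <= r by rewrite le_min ler01 powR_ge0.
have -> : r * (c / K) = r / K * (c / 1) by rewrite divr1; ring.
apply: (stable_kernel_shell_lower K1 c0 (lexx 1) _ (shell _ (lexx 1))).
  by rewrite divr_ge0// ltW.
move=> u u1 uK; have u0 : 0 < u by lra.
rewrite le_min; apply/andP; split.
  rewrite ler_pM ?invr_ge0 ?(ltW Kp)//; first by rewrite /r ge_min lexx orbT.
  by rewrite lef_pV2 ?posrE//; lra.
apply: (@le_trans _ _ 1); last by rewrite powR_ge1// ltW.
rewrite ler_pdivrMr// mul1r; apply: (@le_trans _ _ 1); last exact: ltW.
by rewrite /r ge_min lexx.
Qed.

(** Values of [U] of order 1 dominate. The plain moment, the limit of the kernel integral as [B]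
    grows, is included for the point [x = 0]. *)
Lemma stable_kernel_lt (m : R) : 0 < m -> m < 1 ->
  exists c C : R, [/\ 0 < c, c <= C,
    (c%:E <= \int[P]_x (U x `^ m)%:E /\ \int[P]_x (U x `^ m)%:E <= C%:E)%E
    & forall B : R, 1 <= B ->
    (c%:E <= \int[P]_x (M m B (U x))%:E /\ \int[P]_x (M m B (U x))%:E <= C%:E)%E].
Proof.
move=> m0 m1.
have [C C1 HC] := moment_lt_tail P1 mU U0 two0 upper_tail m0 m1.
have [K [c [K1 c0 shell]]] := dyadic_shell_ge.
have Kp : 0 < K by lra.
have cK : 0 < c / K by exact: divr_gt0.
have lowB B : 1 <= B -> ((c / K)%:E <= \int[P]_x (M m B (U x))%:E)%E.
  move=> B1; have := shell_one K1 c0 m0 (lt_le_trans ltr01 B1) shell.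
  by rewrite min_l ?mul1r// powR_ge1// addr_ge0// ltW.
have low : ((c / K)%:E <= \int[P]_x (U x `^ m)%:E)%E.
  exact: le_trans (lowB 1 (lexx 1)) (stable_kernel_le_moment m 1).
exists (c / K), C; split => //.
  by rewrite -lee_fin (le_trans low).
move=> B B1; split; first exact: lowB.
exact: le_trans (stable_kernel_le_moment m B) HC.
Qed.

Lemma stable_kernel_small (m : R) : 0 < m ->
  exists c C : R, [/\ 0 < c, c <= C & forall B : R, 0 < B -> B <= 1 ->
  ((c * B `^ (1 + m))%:E <= \int[P]_x (M m B (U x))%:E /\
   \int[P]_x (M m B (U x))%:E <= (C * B `^ (1 + m))%:E)%E].
Proof.
move=> m0; have [C C1 HC] := stable_kernel_small_upper m.
have [K [c [K1 c0 shell]]] := dyadic_shell_ge.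
have Kp : 0 < K by lra.
have cK : 0 < c / K by exact: divr_gt0.
exists (c / K), (c / K + C); split => // [|B B0 B1]; first lra.
split.
  have := shell_one K1 c0 m0 B0 shell.
  rewrite min_r; first by rewrite mulrC.
  rewrite -[leRHS](one_powR (1 + m)) ge0_ler_powR ?nnegrE//; last exact: ltW.
  by rewrite addr_ge0// ltW.
apply: (le_trans (HC B B0)); rewrite lee_fin ler_wpM2r ?powR_ge0//; lra.
Qed.

(** The shells are disjoint, so at most one term is nonzero, and it is the left end of the shell
    holding [u]. *)
Lemma geometric_shells_le (K u : R) (n : nat) : 1 < K -> 0 <= u ->
  \sum_(k < n) K ^+ k * (u \in `]K ^+ k, K * K ^+ k]%R)%:R <= u * (u \in `]-oo, K ^+ n]%R)%:R.
Proof.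
move=> K1 u0; have Kp : 0 < K by lra.
elim: n => [|n IH]; first by rewrite big_ord0 mulr_ge0.
rewrite big_ord_recr/= -exprS; move: IH; rewrite !in_itv/=.
have Kn : K ^+ n <= K ^+ n.+1 by rewrite exprS ler_peMl ?exprn_ge0 ?ltW.
case: (leP u (K ^+ n)) => uK /= IH.
  by rewrite mulr0 addr0 (le_trans IH)// (le_trans uK).
rewrite mulr0 in IH; case: (leP u (K ^+ n.+1)) => _; last by rewrite !mulr0 addr0.
by rewrite !mulr1 -[leRHS]add0r lerD// ltW.
Qed.

(** For [m = 1] the kernel is [u] itself below [B], so each shell []K^k, K^(k+1)]] under [B] gives
    at least [K^k * c/K^k = c], whatever [k]. *)
Lemma stable_kernel_eq :
  exists c C : R, [/\ 0 < c, c <= C & forall B : R, 1 <= B ->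
  ((c * (ln B + 1))%:E <= \int[P]_x (M 1 B (U x))%:E /\
   \int[P]_x (M 1 B (U x))%:E <= (C * (ln B + 1))%:E)%E].
Proof.
have [K0 K01 HK0] := truncated_moment_eq_tail P1 mU U0 two0 upper_tail ltr01.
have [K [c [K1 c0 shell]]] := dyadic_shell_ge.
have Kp : 0 < K by lra.
have lK : 0 < ln K by exact: ln_gt0.
(* The factor [K] is for [B < K], where no full shell fits and only the bound [c/K] of [shell_one]
   is left. The factor 2 absorbs the rounding [ln B <= (n+1) ln K <= 2n ln K] for [n >= 1]. *)
pose c1 := c / (2 * K * (ln K + 1)).
have c10 : 0 < c1 by rewrite divr_gt0// !mulr_gt0//; lra.
exists c1, (c1 + K0 + 2); split => // [|B B1]; first lra.
have B0 : 0 < B by lra.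
have L0 : 0 <= ln B by exact: ln_ge0.
split; last first.
  apply: (le_trans (stable_kernel_le_truncated ltr01 B0)).
  rewrite subrr powRr0 mulr1.
  apply: (@le_trans _ _ ((K0 * (ln B + 1))%:E + 2%:E)%E); first by rewrite leeD2r// HK0.
  rewrite -EFinD lee_fin; nra.
have [n [n1 n2 _]] := dyadic_floor K1 B1.
have low0 : ((c / K)%:E <= \int[P]_x (M 1 B (U x))%:E)%E.
  have := shell_one K1 c0 ltr01 B0 shell.
  by rewrite min_l ?mul1r// powR_ge1.
have lown : ((n%:R * c)%:E <= \int[P]_x (M 1 B (U x))%:E)%E.
  apply: (@le_trans _ _ (\int[P]_x (\sum_(k < n) K ^+ k * (U x \in `]K ^+ k, K * K ^+ k]%R)%:R)%:E)%E).
    under eq_integral do rewrite -sumEFin.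
    rewrite ge0_integral_sum//; last 2 first.
    - by move=> k; apply/measurable_EFinP/measurable_funM => //; exact: measurable_itv_indic.
    - by move=> k x _; rewrite lee_fin mulr_ge0 ?exprn_ge0// ltW.
    rewrite (_ : n%:R * c = \sum_(k < n) c); last by rewrite sumr_const card_ord mulr_natl.
    rewrite -sumEFin; apply: lee_sum => k _.
    have Kk : 0 < K ^+ k by exact: exprn_gt0.
    rewrite integral_itv_indic ?(ltW Kk)// -[c](@mulfVK _ (K ^+ k)) ?gt_eqF// mulrC EFinM.
    rewrite lee_pmul2l ?lte_fin//; apply: shell; exact: exprn_ege1 (ltW K1).
  apply: le_integral_fin => [| |x|x].
  - by apply: measurable_sum => k; apply: measurable_funM => //; exact: measurable_itv_indic.
  - exact: measurable_stable_kernel.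
  - by rewrite sumr_ge0// => k _; rewrite mulr_ge0 ?exprn_ge0// ltW.
  - apply: (le_trans (geometric_shells_le n K1 (U0 x))); rewrite in_itv/=.
    case: (leP (U x) (K ^+ n)) => [un|_]; last by rewrite mulr0 stable_kernel_ge0.
    rewrite mulr1 le_min powRr1// lexx andbT.
    have [->|u0] := eqVneq (U x) 0; first by rewrite invr0 mulr0.
    have up : 0 < U x by rewrite lt0r u0 U0.
    rewrite ler_pdivlMr// powRBD1// powRr1 ?(ltW B0)//.
    by rewrite ler_pM// (le_trans un).
have lnB : ln B <= n.+1%:R * ln K.
  rewrite mulr_natl -lnXn// ler_ln ?posrE ?exprn_gt0//; exact: ltW.
have c1E : c1 * (2 * K * (ln K + 1)) = c by rewrite divfK ?gt_eqF ?mulr_gt0//; lra.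
case: n => [|n] in n1 n2 lown lnB *.
  apply: le_trans low0; rewrite lee_fin ler_pdivlMr// -c1E.
  nra.
apply: le_trans lown; rewrite lee_fin -c1E -natr1.
rewrite -!natr1 in lnB; have n0 : 0 <= n%:R :> R by [].
rewrite mulrCA ler_wpM2l ?(ltW c10)//.
apply: (@le_trans _ _ ((n%:R + 1) * (2 * (ln K + 1)))).
  by have := mulr_ge0 n0 (ltW lK); nra.
rewrite ler_wpM2l ?addr_ge0// mulrAC ler_peMr ?mulr_ge0// ?ltW//; lra.
Qed.

End stable.

(* Unlike [ge0_le_integral], no measurability: none is available for the map
   [s |-> G_psi lam alpha h s x]. *)
Lemma ge0_le_integral_nomeas d (T : measurableType d) (R : realType)
    (mu : {measure set T -> \bar R}) (D : set T) (f g : T -> \bar R) :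
  (forall x, D x -> 0 <= f x)%E -> (forall x, D x -> f x <= g x)%E ->
  (\int[mu]_(x in D) f x <= \int[mu]_(x in D) g x)%E.
Proof.
move=> f0 fg; have g0 x : D x -> (0 <= g x)%E by move=> Dx; exact: le_trans (f0 _ Dx) (fg _ Dx).
rewrite !ge0_integralE//; apply: le_ereal_sup => _ [h hf <-]; exists h => // x.
by rewrite (le_trans (hf x))//; exact: lee_restrict.
Qed.

(** * The one-sided stable law and the subordination integral *)

Section stable_density.
Context (R : realType) (beta : R) (w : R -> R).
Hypotheses (beta01 : 0 < beta < 1) (sw : is_stable_density beta w).
Notation leb := (@lebesgue_measure R).

Let mw : measurable_fun (@posR R) w. Proof. by case: sw. Qed.
Let w0 x : 0 < x -> 0 <= w x. Proof. by case: sw => _ [+ _]; exact. Qed.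
Let b0 : 0 < beta. Proof. by case/andP: beta01. Qed.

(** The Laplace identity is given for [lambda > 0] only; here [lambda = 1/(n+1)] decreases to 0, by
    monotone convergence on one side and continuity on the other. *)
Lemma stable_density_mass : (\int[leb]_(x in @posR R) (w x)%:E = 1)%E.
Proof.
have mpos := @measurable_posR R.
pose g n x := (expR (- (harmonic n * x)) * w x)%:E.
have mg n : measurable_fun (@posR R) (g n).
  apply/measurable_EFinP; apply: measurable_funM => //.
  apply: measurable_funTS; apply: measurableT_comp => //; apply: measurableT_comp => //.
have -> : (\int[leb]_(x in @posR R) (w x)%:E =
    limn (fun n => \int[leb]_(x in @posR R) g n x))%E.
  rewrite -monotone_convergence//.
  - apply: eq_integral => x; rewrite in_posR => x0; apply/esym/cvg_lim => //.
    apply: cvg_EFin; first exact: nearW.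
    rewrite -[X in _ --> X]mul1r; apply: cvgMl.
    rewrite -expR0 -oppr0 -(mul0r x).
    apply: (@cvg_comp _ _ _ _ expR); last exact: continuous_expR.
    by apply: cvgN; apply: cvgMl; exact: cvg_harmonic.
  - by move=> n x; rewrite posRE => x0; rewrite lee_fin mulr_ge0 ?expR_ge0 ?w0.
  - move=> x; rewrite posRE => x0 i j ij; rewrite lee_fin ler_wpM2r ?w0//.
    rewrite ler_expR lerN2 ler_wpM2r ?(ltW x0)// /harmonic lef_pV2 ?posrE//.
    by rewrite ler_nat.
apply/cvg_lim => //.
rewrite (_ : (fun n => _) = (fun n => (expR (- (harmonic n `^ beta)))%:E)); last first.
  by apply/funext => n; rewrite /g; case: sw => _ [_ ->] //; rewrite harmonic_gt0.
apply: cvg_EFin; first exact: nearW.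
rewrite -expR0 -oppr0.
apply: (@cvg_comp _ _ _ _ expR); last exact: continuous_expR.
apply: cvgN.
have /cvg_at_rightP := powR_cvg0 b0.
by apply; split; [exact: harmonic_gt0|exact: cvg_harmonic].
Qed.

Let wpos := w \_ (@posR R).

Lemma measurable_stable_density : measurable_fun setT wpos.
Proof. exact: (measurable_restrictT _ (@measurable_posR R)).1. Qed.

Lemma stable_density_ge0 x : 0 <= wpos x.
Proof. by apply: restrict_ge0 => y; rewrite posRE; exact: w0. Qed.

Definition stable_law := density leb measurable_stable_density stable_density_ge0.

Lemma integral_stable_law (f : R -> R) : measurable_fun setT f -> (forall x, 0 <= f x) ->
  (\int[stable_law]_x (f x)%:E = \int[leb]_(x in @posR R) (f x * w x)%:E)%E.
Proof.
move=> mf f0; rewrite /stable_law ge0_integral_density//; last first.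
  exact/measurable_EFinP.
rewrite [RHS]integral_mkcond; apply: eq_integral => x _.
by rewrite /wpos /patch; case: ifP => // _; rewrite mule0.
Qed.

Lemma stable_law_mass : stable_law setT = 1%E.
Proof.
rewrite -(mul1e (stable_law _)) -integral_cst//.
rewrite (integral_stable_law (f := cst 1))//.
by under eq_integral do rewrite mul1r; exact: stable_density_mass.
Qed.

Lemma stable_law_laplace (a : R) : 0 < a ->
  (\int[stable_law]_x (expR (- (x `^ beta / a) `^ beta^-1))%:E = (expR (- a^-1))%:E)%E.
Proof.
move=> a0; rewrite integral_stable_law; last 2 first.
- apply: measurableT_comp => //; apply: measurableT_comp => //.
  apply: (measurableT_comp (measurable_powR _)); apply: measurable_funM => //.
- by move=> x; exact: expR_ge0.
have l0 : 0 < a^-1 `^ beta^-1 by rewrite powR_gt0 ?invr_gt0.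
have := sw.2.2 _ l0; rewrite -powRrM mulVf ?gt_eqF// powRr1 ?invr_ge0 ?(ltW a0)// => <-.
apply: eq_integral => x; rewrite in_posR => x0.
by rewrite powRM ?invr_ge0 ?powR_ge0 ?(ltW a0)// -powRrM mulfV ?gt_eqF// powRr1 ?(ltW x0)// (mulrC x).
Qed.

(** Only the measurable comparison function [k] undergoes the substitution; [G] is compared with it
    on the [z] side, pointwise. *)
Lemma subordination_bounds (G k : R -> R) (c0 C0 c1 C1 : R) :
  0 < c0 -> 0 < C0 -> measurable_fun setT k -> (forall z, 0 < z -> 0 <= k z) ->
  (forall z, 0 < z -> c0 * k z <= G z <= C0 * k z) ->
  (c1%:E <= \int[leb]_(v in @posR R) (k (v `^ (- beta)) * w v)%:E)%E ->
  (\int[leb]_(v in @posR R) (k (v `^ (- beta)) * w v)%:E <= C1%:E)%E ->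
  c0 * c1 <= beta^-1 * Rintegral leb (@posR R)
     (fun z => G z * z `^ (- 1 - beta^-1) * w (z `^ (- beta^-1))) <= C0 * C1.
Proof.
move=> c00 C00 mk k0 kG; have mpos := @measurable_posR R; set q := beta^-1.
have q0 : 0 < q by rewrite invr_gt0.
pose h z := k z * z `^ (- 1 - q) * w (z `^ (- q)).
set f := fun z => G z * _ * _.
have h0 z : 0 < z -> 0 <= h z by move=> z0; rewrite !mulr_ge0 ?powR_ge0 ?k0 ?w0 ?powR_gt0.
have mh : measurable_fun (@posR R) h.
  apply: measurable_funM.
    by apply: measurable_funTS; apply: measurable_funM => //; exact: measurable_powR.
  apply: (measurable_comp (@measurable_posR R)) mw _.
    by move=> _ /= [z + <-]; rewrite !posRE; exact: powR_gt0.
  by apply: measurable_funTS; exact: measurable_powR.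
have mhE : measurable_fun (@posR R) (EFin \o h) by exact/measurable_EFinP.
have hE0 z : posR z -> (0 <= (EFin \o h) z)%E by rewrite posRE lee_fin; exact: h0.
have -> : (\int[leb]_(v in @posR R) (k (v `^ (- beta)) * w v)%:E =
    q%:E * \int[leb]_(z in @posR R) (h z)%:E)%E.
  rewrite -(ge0_integral_powR_subst q0); last 2 first.
  - apply/measurable_EFinP; apply: measurable_funM => //; apply: measurable_funTS.
    by apply: measurableT_comp => //; exact: measurable_powR.
  - by move=> v v0; rewrite lee_fin mulr_ge0 ?k0 ?powR_gt0 ?w0.
  rewrite -ge0_integralZl//; last by rewrite lee_fin ltW.
  apply: eq_integral => z; rewrite in_posR => z0.
  rewrite -!EFinM -powRrM mulrNN mulVf ?gt_eqF// powRr1 ?(ltW z0)//.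
  congr (_%:E); rewrite /h (addrC (- 1)); ring.
have lo : (c0%:E * \int[leb]_(z in @posR R) (h z)%:E <= \int[leb]_(z in @posR R) (f z)%:E)%E.
  rewrite -ge0_integralZl//; last by rewrite lee_fin ltW.
  apply: ge0_le_integral_nomeas => z; rewrite posRE => z0.
    by rewrite mule_ge0 ?lee_fin ?(ltW c00) ?h0.
  rewrite -EFinM lee_fin /h /f !mulrA ler_wpM2r ?w0 ?powR_gt0// ler_wpM2r ?powR_ge0//.
  by case/andP: (kG z z0).
have hi : (\int[leb]_(z in @posR R) (f z)%:E <= C0%:E * \int[leb]_(z in @posR R) (h z)%:E)%E.
  rewrite -ge0_integralZl//; last by rewrite lee_fin ltW.
  apply: ge0_le_integral_nomeas => z; rewrite posRE => z0; have /andP[G1 G2] := kG z z0.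
    rewrite lee_fin !mulr_ge0 ?w0 ?powR_gt0 ?powR_ge0//.
    by rewrite (le_trans _ G1)// mulr_ge0 ?k0// ltW.
  by rewrite -EFinM lee_fin /h /f !mulrA ler_wpM2r ?w0 ?powR_gt0// ler_wpM2r ?powR_ge0.
rewrite /Rintegral.
have I0 : (0 <= \int[leb]_(z in @posR R) (h z)%:E)%E by exact: integral_ge0.
(* [Rintegral] reads an infinite integral as 0, so finiteness must come first: an infinite integral
   of [h] contradicts the bound [C1], and [hi] then bounds that of [f]. *)
move: lo hi I0; case: (\int[leb]_(z in @posR R) (h z)%:E)%E => [I| |]//; last first.
  by move=> _ _ _ _; rewrite mulry gtr0_sg// mul1e.
move=> lo hi I0; rewrite -EFinM !lee_fin => I1 I2.
move: lo hi; case: (\int[leb]_(z in @posR R) (f z)%:E)%E => [J| |]//=.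
rewrite -!EFinM !lee_fin => lo hi; apply/andP; split.
  apply: (@le_trans _ _ (c0 * (q * I))); first by rewrite ler_pM2l.
  by rewrite mulrCA ler_pM2l.
apply: (@le_trans _ _ (C0 * (q * I))); last by rewrite ler_pM2l.
by rewrite [leRHS]mulrCA ler_pM2l.
Qed.

End stable_density.

(** * The subordinated Green's function *)

Lemma enorm_gt0 (R : realType) d (x : 'rV[R]_d) : x != 0 -> 0 < enorm x.
Proof.
move=> x0; rewrite sqrtr_gt0 lt0r.
have D0 : 0 <= dotp x x by apply: sumr_ge0 => i _; rewrite -expr2 sqr_ge0.
rewrite D0 andbT; apply: contra x0 => /eqP D.
apply/eqP/rowP => i; rewrite mxE; apply/eqP.
rewrite -sqrf_eq0 expr2; apply/eqP.
by apply: (psumr_eq0P _ D) => // j _; rewrite -expr2 sqr_ge0.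
Qed.

Section scaling.
Context (R : realType) (d : nat) (alpha beta t : R) (x : 'rV[R]_d).
Hypotheses (a0 : 0 < alpha) (t0 : 0 < t).
Let m : R := d%:R / alpha.
Let Om : R := enorm x `^ alpha * t `^ (- beta).

(** Since [|x|^(-d-alpha)] is the power [-1-m] of [|x|^alpha], factoring out the power of [t] leaves
    [Omega] as the only parameter. *)
Lemma Gbound_scale (z : R) : x != 0 -> 0 < z ->
  Gbound alpha (t `^ beta * z) x =
  t `^ (- (d%:R * beta / alpha)) * Num.min (Om `^ (- 1 - m) * z) (z `^ (- m)).
Proof.
move=> x0 z0; have r0 := enorm_gt0 x0; rewrite /Gbound (negbTE x0) minr_pMr ?powR_ge0//.
have tz : (t `^ beta * z) `^ (- (d%:R / alpha)) = t `^ (- (d%:R * beta / alpha)) * z `^ (- m).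
  rewrite powRM ?powR_ge0 ?(ltW z0)// -powRrM; congr (t `^ _ * _); ring.
rewrite tz; congr Num.min.
rewrite /Om powRM ?powR_ge0// -!powRrM.
have -> : alpha * (- 1 - m) = - (d%:R + alpha) by rewrite /m; field; rewrite gt_eqF.
have -> : t `^ beta = t `^ (- (d%:R * beta / alpha)) * t `^ (- beta * (- 1 - m)).
  rewrite -powRD ?(gt_eqF t0) ?implybT//; congr (_ `^ _); rewrite /m; ring.
ring.
Qed.

Lemma Gbound_scale0 (z : R) : x = 0 -> 0 < z ->
  Gbound alpha (t `^ beta * z) x = t `^ (- (d%:R * beta / alpha)) * z `^ (- m).
Proof.
move=> -> z0; rewrite /Gbound eqxx powRM ?powR_ge0 ?(ltW z0)// -powRrM.
congr (t `^ _ * _); ring.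
Qed.

Lemma Omega_gt0 : x != 0 -> 0 < Om.
Proof. by move=> x0; rewrite mulr_gt0 ?powR_gt0 ?enorm_gt0. Qed.

End scaling.

(** * The bounds for small and for large [Omega] *)

Section main.
Context (R : realType) (d : nat) (alpha beta : R)
  (lam : {measure set (d.-tuple R) -> \bar R})
  (h : 'rV[R]_d -> R) (w : R -> R).
Hypotheses (a0 : 0 < alpha) (beta01 : 0 < beta < 1) (sw : is_stable_density beta w).
Variables (c0 C0 : R).
Hypotheses (c00 : 0 < c0) (C00 : 0 < C0).
Hypothesis G_bounds : forall (s : R) (x : 'rV[R]_d), 0 < s ->
  c0 * Gbound alpha s x <= G_psi lam alpha h s x <= C0 * Gbound alpha s x.
Let m : R := d%:R / alpha.
Let b0 : 0 < beta. Proof. by case/andP: beta01. Qed.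
Let U (v : R) := v `^ beta.
Let P := stable_law sw.
Notation leb := (@lebesgue_measure R).
Notation tt t := (t `^ (- (d%:R * beta / alpha))).

Let mU : measurable_fun setT U. Proof. exact: measurable_powR. Qed.

Lemma G_beta_bounds (t : R) (x : 'rV[R]_d) (c1 C1 : R) : 0 < t -> x != 0 ->
  let Om := enorm x `^ alpha * t `^ (- beta) in
  (c1%:E <= \int[P]_v (stable_kernel m Om^-1 (U v))%:E)%E ->
  (\int[P]_v (stable_kernel m Om^-1 (U v))%:E <= C1%:E)%E ->
  c0 * (tt t * c1) <= G_beta lam alpha h beta w t x <= C0 * (tt t * C1).
Proof.
move=> t0 x0 Om; have Om0 : 0 < Om by exact: Omega_gt0.
have T0 : 0 < tt t by exact: powR_gt0.
rewrite !mulrA.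
pose k z := Num.min (Om `^ (- 1 - m) * z) (z `^ (- m)).
have mk : measurable_fun setT k.
  apply: measurable_minr; first exact: measurable_funM.
  exact: measurable_powR.
have kU v : 0 < v -> k (v `^ (- beta)) = stable_kernel m Om^-1 (U v).
  move=> v0; rewrite /k /stable_kernel /U; congr Num.min.
    rewrite powRN; congr (_ * _).
    by rewrite -[Om^-1]powR_inv1 ?(ltW Om0)// -powRrM mulN1r opprD.
  by rewrite -!powRrM mulrN mulNr opprK.
rewrite integral_stable_law; last 2 first.
- by apply: measurable_stable_kernel => // v; exact: powR_ge0.
- by move=> v; apply: stable_kernel_ge0; exact: powR_ge0.
move=> I1 I2; rewrite /G_beta.
apply: (@subordination_bounds _ _ w beta01 sw (fun z => G_psi lam alpha h (t `^ beta * z) x) k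
  (c0 * tt t) (C0 * tt t) c1 C1).
- exact: mulr_gt0.
- exact: mulr_gt0.
- exact: mk.
- by move=> z z0; rewrite le_min mulr_ge0 ?powR_ge0// ltW.
- move=> z z0.
  have kG : tt t * k z = Gbound alpha (t `^ beta * z) x.
    by rewrite (Gbound_scale beta a0 t0 x0 z0).
  rewrite -(mulrA c0) -(mulrA C0) kG.
  by apply: G_bounds; rewrite mulr_gt0 ?powR_gt0.
- by under eq_integral => v do [rewrite in_posR => v0; rewrite kU//].
- by under eq_integral => v do [rewrite in_posR => v0; rewrite kU//].
Qed.

(** At [x = 0] the inverse of [Omega] is 0 by convention, so [stable_kernel] no longer describes the
    integrand; [Gbound] is a pure power there and leads to [E U^m]. *)
Lemma G_beta_bounds0 (t : R) (c1 C1 : R) : 0 < t ->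
  (c1%:E <= \int[P]_v (U v `^ m)%:E)%E ->
  (\int[P]_v (U v `^ m)%:E <= C1%:E)%E ->
  c0 * (tt t * c1) <= G_beta lam alpha h beta w t 0 <= C0 * (tt t * C1).
Proof.
move=> t0; have T0 : 0 < tt t by exact: powR_gt0.
rewrite !mulrA.
have kU (v : R) : 0 < v -> (v `^ (- beta)) `^ (- m) = U v `^ m.
  by move=> v0; rewrite /U -!powRrM mulrN mulNr opprK.
rewrite integral_stable_law; last 2 first.
- exact: measurableT_comp (measurable_powR _) mU.
- by move=> v; exact: powR_ge0.
move=> I1 I2; rewrite /G_beta.
apply: (@subordination_bounds _ _ w beta01 sw (fun z => G_psi lam alpha h (t `^ beta * z) 0)
  (fun z => z `^ (- m)) (c0 * tt t) (C0 * tt t) c1 C1).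
- exact: mulr_gt0.
- exact: mulr_gt0.
- exact: measurable_powR.
- by move=> z z0; exact: powR_ge0.
- move=> z z0.
  have kG : tt t * z `^ (- m) = Gbound alpha (t `^ beta * z) (0 : 'rV[R]_d).
    by rewrite (Gbound_scale0 alpha beta t erefl z0).
  rewrite -(mulrA c0) -(mulrA C0) kG.
  by apply: G_bounds; rewrite mulr_gt0 ?powR_gt0.
- by under eq_integral => v do [rewrite in_posR => v0; rewrite kU//].
- by under eq_integral => v do [rewrite in_posR => v0; rewrite kU//].
Qed.

Hypothesis (d0 : (0 < d)%N).
Let m0 : 0 < m. Proof. by rewrite divr_gt0 ?ltr0n. Qed.
Let b1 : 1 < beta^-1. Proof. by rewrite invf_gt1//; case/andP: beta01. Qed.
Let P1 := stable_law_mass beta01 sw.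
Let Plap := stable_law_laplace beta01 sw.
Let U0 v : 0 <= U v. Proof. exact: powR_ge0. Qed.

(** The disjunction reflects that at [x = 0] the comparison integral is [E U^m], finite only for
    [m < 1]. *)
Lemma G_beta_small_Omega : exists c C : R, [/\ 0 < c, c <= C &
  forall (t : R) (x : 'rV[R]_d), 0 < t -> x != 0 \/ d%:R < alpha ->
  let Om := enorm x `^ alpha * t `^ (- beta) in Om <= 1 ->
  c * Fsmall d alpha beta t Om <= G_beta lam alpha h beta w t x
    <= C * Fsmall d alpha beta t Om].
Proof.
rewrite /Fsmall; have [da|da|da] := ltgtP d%:R alpha.
- have m1 : m < 1 by rewrite ltr_pdivrMr// mul1r.
  have [c [C [cp cC [Ul Uu] H]]] := stable_kernel_lt P1 mU U0 b1 Plap m0 m1.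
  (* Adding the lower constant to the upper one makes [c <= C] immediate. *)
  exists (c0 * c), (c0 * c + C0 * C); split.
  + exact: mulr_gt0.
  + by rewrite lerDl mulr_ge0// ltW// (lt_le_trans cp).
  move=> t x t0 _; set Om := enorm x `^ alpha * _ => Om1; have T0 := powR_ge0 t (- (d%:R * beta / alpha)).
  have /andP[lo hi] : c0 * (tt t * c) <= G_beta lam alpha h beta w t x <= C0 * (tt t * C).
    have [x0|x0] := eqVneq x 0; first by rewrite x0; exact: G_beta_bounds0.
    have Om0 : 0 < Om by exact: Omega_gt0.
    have [|H1 H2] := H Om^-1; first by rewrite invf_ge1.
    exact: G_beta_bounds.
  rewrite -mulrA (mulrC c) lo/= (le_trans hi)//.
  by rewrite mulrDl mulrA mulrAC lerDr !mulr_ge0// ltW.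
- have m1 : 1 < m by rewrite ltr_pdivlMr// mul1r.
  have [c [C [cp cC H]]] := stable_kernel_gt P1 mU U0 b1 Plap m1.
  exists (c0 * c), (c0 * c + C0 * C); split.
  + exact: mulr_gt0.
  + by rewrite lerDl mulr_ge0// ltW// (lt_le_trans cp).
  move=> t x t0 x0; set Om := enorm x `^ alpha * _ => Om1; have T0 := powR_ge0 t (- (d%:R * beta / alpha)).
  have {}x0 : x != 0 by case: x0 => //; rewrite ltNge (ltW da).
  have Om0 : 0 < Om by exact: Omega_gt0.
  have [|] := H Om^-1; first by rewrite invf_ge1.
  move=> /G_beta_bounds /[apply] /(_ t0 x0) /andP[].
  rewrite (_ : Om^-1 `^ (m - 1) = Om `^ (1 - d%:R / alpha)); last first.
    by rewrite -[Om^-1]powR_inv1 ?(ltW Om0)// -powRrM mulN1r opprB.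
  set F := Om `^ _; have F0 : 0 <= F by exact: powR_ge0.
  move=> lo hi; apply/andP; split.
    by rewrite (_ : c0 * c * _ = c0 * (tt t * (c * F)))//; ring.
  by rewrite (le_trans hi)// mulrDl (_ : C0 * C * _ = C0 * (tt t * (C * F)));
    [rewrite lerDr !mulr_ge0// ltW|ring].
- have m1 : m = 1 by rewrite /m da divff ?gt_eqF.
  have [c [C [cp cC H]]] := stable_kernel_eq P1 mU U0 b1 Plap.
  exists (c0 * c), (c0 * c + C0 * C); split.
  + exact: mulr_gt0.
  + by rewrite lerDl mulr_ge0// ltW// (lt_le_trans cp).
  move=> t x t0 x0; set Om := enorm x `^ alpha * _ => Om1.
  have {}x0 : x != 0 by case: x0 => //; rewrite da ltxx.
  have Om0 : 0 < Om by exact: Omega_gt0.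
  have [|] := H Om^-1; first by rewrite invf_ge1.
  rewrite -[X in stable_kernel X]m1 => /G_beta_bounds /[apply] /(_ t0 x0) /andP[].
  have -> : d%:R * beta / alpha = beta by rewrite da mulrAC divff ?mul1r ?gt_eqF.
  have -> : ln Om^-1 = `|ln Om| by rewrite lnV// ler0_norm// ln_le0.
  have T0 := powR_ge0 t (- beta).
  set F := `|ln Om| + 1; have F0 : 0 <= F by rewrite addr_ge0.
  move=> lo hi; apply/andP; split.
    by rewrite (_ : c0 * c * _ = c0 * (t `^ (- beta) * (c * F)))//; ring.
  by rewrite (le_trans hi)// mulrDl (_ : C0 * C * _ = C0 * (t `^ (- beta) * (C * F)));
    [rewrite lerDr !mulr_ge0// ltW|ring].
Qed.

Lemma G_beta_large_Omega : exists c C : R, [/\ 0 < c, c <= C &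
  forall (t : R) (x : 'rV[R]_d), 0 < t ->
  let Om := enorm x `^ alpha * t `^ (- beta) in 1 <= Om ->
  c * (tt t * Om `^ (- 1 - d%:R / alpha)) <= G_beta lam alpha h beta w t x
    <= C * (tt t * Om `^ (- 1 - d%:R / alpha))].
Proof.
have [c [C [cp cC H]]] := stable_kernel_small P1 mU U0 b1 Plap m0.
exists (c0 * c), (c0 * c + C0 * C); split.
- exact: mulr_gt0.
- by rewrite lerDl mulr_ge0// ltW// (lt_le_trans cp).
move=> t x t0 Om Om1; have T0 := powR_ge0 t (- (d%:R * beta / alpha)).
have x0 : x != 0.
  apply/eqP => x0; move: Om1; rewrite /Om x0 /enorm.
  rewrite (_ : dotp 0 0 = 0 :> R); last by apply: big1 => i _; rewrite mxE mul0r.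
  by rewrite sqrtr0 powR0 ?gt_eqF// mul0r ler10.
have Om0 : 0 < Om by exact: Omega_gt0.
have [||] := H Om^-1; [by rewrite invr_gt0|by rewrite invf_le1|].
move=> /G_beta_bounds /[apply] /(_ t0 x0) /andP[].
rewrite (_ : Om^-1 `^ (1 + m) = Om `^ (- 1 - d%:R / alpha)); last first.
  by rewrite -[Om^-1]powR_inv1 ?(ltW Om0)// -powRrM mulN1r opprD.
set F := Om `^ _; have F0 : 0 <= F by exact: powR_ge0.
move=> lo hi; apply/andP; split.
  by rewrite (_ : c0 * c * _ = c0 * (tt t * (c * F)))//; ring.
by rewrite (le_trans hi)// mulrDl (_ : C0 * C * _ = C0 * (tt t * (C * F)));
  [rewrite lerDr !mulr_ge0// ltW|ring].
Qed.

End main.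

Theorem theorem2 (R : realType) (d : nat) (alpha beta : R)
  (lam : {measure set (d.-tuple R) -> \bar R})
  (h : 'rV[R]_d -> R) (w : R -> R) :
  (0 < d)%N ->
  0 < alpha < 2 ->
  0 < beta < 1 ->
  is_lebesgue_Rd lam ->
  (* mu = h sigma is a finite measure on S^{d-1} with strictly positive density *)
  measurable_fun setT (fun t => h (normalize (tup2row t))) ->
  (forall s : 'rV[R]_d, enorm s = 1 -> 0 < h s) ->
  (sph_int_e lam h < +oo)%E ->
  (* w_mu in C^{d+1+[alpha]}(S^{d-1}) and w_mu >= w0 > 0 *)
  Ck_sphere (d + 1 + Num.truncn alpha)%N (w_mu lam alpha h) ->
  (exists w0 : R, 0 < w0 /\
     forall p : 'rV[R]_d, enorm p = 1 -> w0 <= w_mu lam alpha h p) ->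
  is_stable_density beta w ->
  (* known two-sided estimate for G_{psi_alpha} *)
  (exists c0 C0 : R, 0 < c0 /\ 0 < C0 /\
     forall (s : R) (x y : 'rV[R]_d), 0 < s ->
       c0 * Gbound alpha s (x - y) <= G_psi lam alpha h s (x - y)
       <= C0 * Gbound alpha s (x - y)) ->
  exists c C : R, 0 < c /\ c <= C /\
    forall (t : R) (x y : 'rV[R]_d), 0 < t ->
      (x != y \/ d%:R < alpha) ->
      let Omega := enorm (x - y) `^ alpha * t `^ (- beta) in
      (Omega <= 1 ->
         c * Fsmall d alpha beta t Omega <= G_beta lam alpha h beta w t (x - y)
         <= C * Fsmall d alpha beta t Omega) /\
      (1 <= Omega ->
         c * (t `^ (- (d%:R * beta / alpha)) * Omega `^ (- 1 - d%:R / alpha))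
           <= G_beta lam alpha h beta w t (x - y)
         <= C * (t `^ (- (d%:R * beta / alpha)) * Omega `^ (- 1 - d%:R / alpha))).
Proof.
move=> d0 /andP[a0 _] beta01 _ _ _ _ _ _ sw [c0 [C0 [c00 [C00 HG]]]].
have G_bounds (s : R) (x : 'rV[R]_d) : 0 < s ->
    c0 * Gbound alpha s x <= G_psi lam alpha h s x <= C0 * Gbound alpha s x.
  by move=> s0; have := HG s x 0 s0; rewrite subr0.
have [c1 [C1 [c10 cC1 H1]]] := G_beta_small_Omega a0 beta01 sw c00 C00 G_bounds d0.
have [c2 [C2 [c20 cC2 H2]]] := G_beta_large_Omega a0 beta01 sw c00 C00 G_bounds d0.
have widen (c c' C C' F g : R) : 0 <= F -> c <= c' -> C' <= C ->
    c' * F <= g <= C' * F -> c * F <= g <= C * F.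
  move=> F0 cc CC /andP[lo hi]; apply/andP; split.
    by rewrite (le_trans _ lo)// ler_wpM2r.
  by rewrite (le_trans hi)// ler_wpM2r.
exists (Num.min c1 c2), (Num.max C1 C2); split; [|split].
- by rewrite lt_min c10.
- by rewrite ge_min le_max cC1.
move=> t x y t0 xy Omega; split => Om1.
- apply: widen (H1 t (x - y) t0 _ Om1).
  + rewrite /Fsmall; case: ifP => _; first exact: powR_ge0.
    by case: ifP => _; rewrite mulr_ge0 ?powR_ge0// addr_ge0.
  + by rewrite ge_min lexx.
  + by rewrite le_max lexx.
  + by rewrite subr_eq0.
- apply: widen (H2 t (x - y) t0 Om1).
  + by rewrite mulr_ge0 ?powR_ge0.
  + by rewrite ge_min lexx orbT.
  + by rewrite le_max lexx orbT.
Qed.
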